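(* Let $d\ge1$ be an integer and let $\{B^H(t):t\in[0,1]\}$ be a $d$-dimensional fractional Brownian motion of Hurst index $H\in(0,1)$. Let $A\subset[0,1]$ be a closed set such that $0<\dim(A)\le Hd$. Then for every $\alpha\in(0,\dim(A)/d)$ there exists an $\alpha$-Hölder continuous function $f:[0,1]\to\mathbb{R}^d$ for which the range $(B^H+f)(A)$ has non-empty interior almost surely.
   Context: $\dim$ denotes the usual Hausdorff dimension of subsets of $\mathbb{R}$; $(B^H+f)(A)=\{B^H(t)+f(t):t\in A\}\subset\mathbb{R}^d$ is the (random) image of $A$. The function $f$ is deterministic. A function $f:[0,1]\to\mathbb{R}^d$ is $\alpha$-Hölder continuous if there is $K\ge0$ with $\|f(x)-f(y)\|_\infty\le K|x-y|^\alpha$ for all $x,y\in[0,1]$, where $\|\cdot\|_\infty$ is the maximum norm. A real-valued fractional Brownian motion of Hurst index $H\in(0,1)$ is a centered Gaussian process $B_0^H$ with covariance $\mathbb{E}(B_0^H(s)B_0^H(t))=\frac12(|t|^{2H}+|s|^{2H}-|t-s|^{2H})$. A $d$-dimensional fractional Brownian motion is $B^H=(B_1^H,\dots,B_d^H)$ with $B_1^H,\dots,B_d^H$ independent copies of $B_0^H$. Processes are defined on a complete probability space and taken with continuous sample paths. *)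

(* Defs.v *)
From HB Require Import structures.
From mathcomp Require Import all_boot all_order all_algebra.
From mathcomp Require Import all_classical all_reals all_analysis.

Set Implicit Arguments.
Unset Strict Implicit.
Unset Printing Implicit Defensive.

Import Order.TTheory GRing.Theory Num.Theory.
Import numFieldNormedType.Exports.

Local Open Scope classical_set_scope.
Local Open Scope ring_scope.

Section hausdorff_dimension.
Context {R : realType}.
Implicit Types (A U : set R) (s delta : R).
Local Open Scope ereal_scope.

Definition diameter U : \bar R :=
  maxe 0 (ereal_sup [set (`|p.1 - p.2|%R)%:E | p in U `*` U]).

(* diam(U)^s, with the usual conventions at s = 0: the empty set contributes 0
   and a singleton contributes 1 (poweR takes 0 `^ 0 to be 1). *)
Definition diam_power s U : \bar R :=
  if U == set0 then 0 else poweR (diameter U) s.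

Definition hausdorff_content s delta A : \bar R :=
  ereal_inf [set \sum_(0 <= i <oo) diam_power s (U i) | U in
    [set U : (set R)^nat | A `<=` \bigcup_i U i /\
                           forall i, diameter (U i) <= delta%:E]].

Definition hausdorff_measure s A : \bar R :=
  ereal_sup [set hausdorff_content s delta A | delta in [set x : R | (0 < x)%R]].

Definition hausdorff_dim A : \bar R :=
  ereal_inf [set s%:E | s in [set s : R | (0 <= s)%R /\
                                         hausdorff_measure s A = 0]].

End hausdorff_dimension.

Definition hoelder_on {R : realType} {V : normedModType R} (D : set R)
    (alpha : R) (f : R -> V) :=
  exists K : R, 0 <= K /\
    forall x y : R, D x -> D y -> `|f x - f y| <= K * `|x - y| `^ alpha.

Section gaussian.
Context {d : measure_display} {T : measurableType d} {R : realType}.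
Variable P : probability T R.

(* The case s = 0 is separate because normal_prob m 0 is not the Dirac measure
   at m but, by default, the uniform law on [0, 1]. *)
Definition gaussian_law (m s : R) : set R -> \bar R :=
  if s == 0 then \d_m else normal_prob m s.

Definition gaussian_rv (Y : T -> R) :=
  measurable_fun [set: T] Y /\
  exists m s : R, forall V : set R, measurable V ->
    P (Y @^-1` V) = gaussian_law m s V.

Definition gaussian_process (D : set R) (X : R -> T -> R) :=
  forall (n : nat) (t : 'I_n -> R) (c : 'I_n -> R), (forall k, D (t k)) ->
    gaussian_rv (fun w => \sum_(k < n) c k * X (t k) w).

Definition centered_process (D : set R) (X : R -> T -> R) :=
  forall t, D t -> ('E_P[X t] = 0)%E.

Definition process_sigma_algebra (D : set R) (X : R -> T -> R) : set (set T) :=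
  <<s [set E | exists2 t, D t &
         exists2 V : set R, measurable V & E = X t @^-1` V] >>.

Definition independent_processes (D : set R) (n : nat)
    (X : 'I_n -> R -> T -> R) :=
  forall (J : {set 'I_n}) (E : 'I_n -> set T),
    (forall i, i \in J -> process_sigma_algebra D (X i) (E i)) ->
    P (\bigcap_(i in [set` J]) E i) = (\prod_(i in J) P (E i))%E.

End gaussian.

Section fractional_brownian_motion.
Context {d : measure_display} {T : measurableType d} {R : realType}.
Variable P : probability T R.

(* Processes are indexed by R, but only their values at times in [0, 1] are
   constrained. *)
Definition is_real_fbm (H : R) (X : R -> T -> R) :=
  [/\ gaussian_process P `[0, 1] X,
      centered_process P `[0, 1] X &
      forall s t : R, `[0, 1]%classic s -> `[0, 1]%classic t ->
        ('E_P[(X s \* X t)%R])%E =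
        (2^-1 * (`|t| `^ (2 * H) + `|s| `^ (2 * H)
                 - `|t - s| `^ (2 * H)))%:E].

(* Being a real fractional Brownian motion of index H determines the
   finite-dimensional laws, so the coordinates below are copies of one another. *)
Definition is_fbm (H : R) (n : nat) (B : R -> T -> 'rV[R]_n) :=
  [/\ forall i, is_real_fbm H (fun t w => B t w 0 i),
      independent_processes P `[0, 1] (fun i t w => B t w 0 i) &
      forall w, {within `[0, 1], continuous (fun t => B t w)}].

End fractional_brownian_motion.

(* Main.v *)
Require Import Defs.
From HB Require Import structures.
From mathcomp Require Import all_boot all_order all_algebra.
From mathcomp Require Import all_classical all_reals all_analysis.
From mathcomp Require Import measurable_realfun.
From mathcomp Require Import ring lra zify.

(** Why the theorem is true.  The drift f is a limit of step functions along a
    Cantor set inside A.  Its steps are found by averaging over random ones, in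
    such a way that, for almost every path g of B, the sum g + f spreads the
    mass of A over entire cubes.

    The set A.  Let s be such that d * alpha < s < dim A.  Hausdorff content in
    dimension s has a positive value on A for some mesh delta, and on the line
    x |-> content (A `&` ]-oo, x]) is at once nondecreasing, s-Hoelder and
    constant off A: it is the distribution function of a Frostman measure.  Its
    inverse maps an interval into A and cannot bring points together too much
    (inverse_distribution_function).  Composed with a function that jumps at
    every b-adic point, it gives tau : R -> A such that two points of [0, 1[ in
    distinct b-adic intervals of order n have images at distance at least a
    constant times (2b)^(-n/s) (cantor_parametrization).

    The steps.  On each b-adic interval of order n + 1, f o tau receives a
    displacement (xi - m) / m^(n + 1) with xi in {0, ..., 2m - 1}^d.  The number
    b is a fixed multiple of m^d, so once m is large d * alpha < s bounds m^-n
    by a constant times the power alpha of the distances above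
    (subdivision_choice).  Hence f is alpha-Hoelder on tau [0, 1[
    (limit_hoelder) and extends to the line (hoelder_extension).

    Filling cubes.  Cut R^d into cells of side m^-n and call occupation of a
    cell the measure of the v in [0, 1[ for which g(tau v) plus the first n
    displacements lies in it.  Whatever the path does, a uniform independent
    choice of the next displacements sends every point of the cell into a given
    subcell with probability (2m)^-d; the occupation of the subcell is then a
    sum of b^(n + 1) independent terms of size at most b^-(n + 1), and its mean
    is at least (2m)^-d times the occupation of the cell.  A Chernoff bound
    shows that it falls below a quarter of this with probability at most
    exp (- 2^(n + 1)), provided that the cell is above its threshold
    (4 (2m)^d)^-n (refine_chernoff).  This beats the number of cells in a box
    of radius 2^n.  The bound holds for each path, hence on average over the
    paths, so some fixed choice of displacements is bad for a small set of paths
    only (small_union_of_small_average, exists_refinement), and by Borel-Cantelli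
    almost every path is bad at finitely many levels (eventually_no_drops).
    At level n a bounded path visits fewer cells than the inverse of the
    threshold if n is large, so some cell is above the threshold at every
    late level (first_occupied_cell).  From there on all its descendants stay
    occupied (fills_cell), so every point of the cell is a limit of values of
    B + f on A, hence a value, A being compact. *)

Set Implicit Arguments.
Unset Strict Implicit.
Unset Printing Implicit Defensive.

Import Order.TTheory GRing.Theory Num.Theory.
Import numFieldNormedType.Exports.

Local Open Scope classical_set_scope.
Local Open Scope ring_scope.

(** * A Chernoff bound and averaging over a finite set of choices *)

Lemma expRN_le (R : realType) (x : R) : 0 <= x <= 1 -> expR (- x) <= 1 - x / 2.
Proof.
move=> /andP[x0 x1].
have h := expR_ge1Dx x.
rewrite expRN -div1r ler_pdivrMr ?expR_gt0//.
apply: (@le_trans _ _ ((1 - x / 2) * (1 + x))); first by nra.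
by apply: ler_wpM2l => //; lra.
Qed.

(** The lower tail bound for X = \sum_k a k (c k) with independent uniform
    c k, stated by counting.  The exponential moment of - X / w is a product
    over k, each factor is controlled by exp (- t) <= 1 - t / 2 on [0, 1], and
    Markov's inequality finishes. *)
Lemma chernoff (R : realType) (I X : finType) (a : I -> X -> R) (w mu : R) :
  0 < w -> (0 < #|X|)%N -> (forall k x, 0 <= a k x <= w) ->
  mu <= \sum_k \sum_x a k x ->
  (#|[pred c : {ffun I -> X} | \sum_k a k (c k) < mu / (4 * #|X|%:R)]|)%:R
    <= #|{ffun I -> X}|%:R * expR (- (mu / (4 * #|X|%:R * w))).
Proof.
move=> w0 X0 a0w muS.
set D : R := #|X|%:R; have D0 : 0 < D by rewrite ltr0n.
set y := mu / (4 * D * w).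
(* Markov's inequality for exp (- X / w). *)
have step1 : #|[pred c : {ffun I -> X} | \sum_k a k (c k) < mu / (4 * D)]|%:R
     * expR (- y) <= \sum_(c : {ffun I -> X}) expR (- ((\sum_k a k (c k)) / w)).
  rewrite mulr_natl -sumr_const.
  rewrite [leRHS](bigID [pred c : {ffun I -> X} | \sum_k a k (c k) < mu / (4 * D)])/=.
  rewrite -[leLHS]addr0 lerD//; last by apply: sumr_ge0 => *; exact: expR_ge0.
  apply: ler_sum => c cS; rewrite ler_expR lerN2.
  rewrite /y invfM mulrA ler_pM2r ?invr_gt0//; exact: ltW.
(* Independence of the coordinates of c. *)
have step2 : \sum_(c : {ffun I -> X}) expR (- ((\sum_k a k (c k)) / w))
    = \prod_k \sum_x expR (- (a k x / w)).
  rewrite bigA_distr_bigA/=; apply: eq_bigr => c _.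
  by rewrite -expR_sum mulr_suml sumrN.
have step3 : \prod_k \sum_x expR (- (a k x / w)) <=
    \prod_(k : I) (D * expR (- ((\sum_x a k x) / (2 * D * w)))).
  apply: ler_prod => k _; apply/andP; split.
    by apply: sumr_ge0 => *; exact: expR_ge0.
  apply: (@le_trans _ _ (\sum_x (1 - (a k x / w) / 2))).
    apply: ler_sum => x _; apply: expRN_le.
    have /andP[ge0 lew] := a0w k x.
    by rewrite divr_ge0 ?(ltW w0)//= ler_pdivrMr ?mul1r.
  rewrite sumrB sumr_const -/D -!mulr_suml.
  apply: (@le_trans _ _ (D * (1 - (\sum_x a k x) / (2 * D * w)))).
    by rewrite le_eqVlt; apply/orP; left; apply/eqP; field; rewrite !gt_eqF.
  by rewrite ler_pM2l//; have := expR_ge1Dx (- ((\sum_x a k x) / (2 * D * w))).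
have step4 : \prod_(k : I) (D * expR (- ((\sum_x a k x) / (2 * D * w))))
    <= #|{ffun I -> X}|%:R * expR (- (2 * y)).
  rewrite big_split/= prodr_const -expR_sum card_ffun natrX -/D.
  rewrite ler_pM2l ?exprn_gt0// ler_expR sumrN lerN2 -mulr_suml.
  have -> : 2 * y = mu / (2 * D * w) by rewrite /y; field; rewrite !gt_eqF.
  by rewrite ler_pM2r// invr_gt0 !mulr_gt0.
rewrite step2 in step1; have := le_trans step1 (le_trans step3 step4).
have -> : - (2 * y) = - y + - y by ring.
by rewrite expRD mulrA ler_pM2r ?expR_gt0.
Qed.

Lemma Boole_seq d (T : measurableType d) (R : realType) (mu : {measure set T -> \bar R})
    (I : Type) (s : seq I) (F : I -> set T) : (forall i, measurable (F i)) ->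
  (mu (\big[setU/set0]_(i <- s) F i) <= \sum_(i <- s) mu (F i))%E.
Proof.
move=> mF; elim: s => [|i s IH]; first by rewrite !big_nil measure0.
rewrite !big_cons; apply: le_trans (measureU2 _ _ _) _ => //.
  exact: bigsetU_measurable.
exact: leeD2l.
Qed.

Lemma bigsetU_fin (T : Type) (I : finType) (F : I -> set T) :
  \big[setU/set0]_i F i = [set t | exists i, F i t].
Proof.
apply/seteqP; split=> [t|t [i Fit]].
  by apply: (big_ind (fun A : set T => A t -> exists i, F i t)) => //
    [A B IA IB [/IA//|/IB//]|i _ Fit]; exists i.
by rewrite (bigD1 i)//=; left.
Qed.

(** The probabilistic method on a finite set of choices: for each outcome w
    few choices c are bad, so on average over c, by exchanging the sum and the
    expectation, the bad events have small probability, and some c does not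
    exceed the average. *)
Lemma small_union_of_small_average d (T : measurableType d) (R : realType)
    (P : probability T R) (X J : finType) (bad : X -> J -> set T) (e : R) :
  (0 < #|X|)%N -> (forall c j, measurable (bad c j)) ->
  (forall j w, #|[pred c | `[< bad c j w >] ]|%:R <= #|X|%:R * e) ->
  exists c, (P [set w | exists j, bad c j w] <= (#|J|%:R * e)%:E)%E.
Proof.
move=> /card_gt0P[c0 _] mb hb.
have mU c : measurable [set w | exists j, bad c j w].
  by rewrite -bigsetU_fin; exact: bigsetU_measurable.
have sumj j : (\sum_(c : X) P (bad c j) <= (#|X|%:R * e)%:E)%E.
  have -> : (\sum_(c : X) P (bad c j) = \int[P]_w \sum_(c : X) (\1_(bad c j) w)%:E)%E.
    rewrite ge0_integral_sum//=; last first.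
      by move=> c; apply/measurable_EFinP; exact: measurable_indic.
    by apply: eq_bigr => c _; rewrite integral_indic// setIT.
  rewrite -[leRHS]mule1 -(@probability_setT _ _ _ P) -integral_cst//.
  apply: ge0_le_integral => //=.
  - by move=> w _; apply: sume_ge0 => c _; rewrite lee_fin.
  - by apply: emeasurable_sum => c; apply/measurable_EFinP; exact: measurable_indic.
  - move=> w _; rewrite sumEFin lee_fin; apply: le_trans (hb j w).
    rewrite le_eqVlt; apply/orP; left; apply/eqP.
    rewrite -sum1_card natr_sum [RHS]big_mkcond/=; apply: eq_bigr => c _.
    rewrite indicE; case: ifP => [/asboolP h|/asboolP h]; first by rewrite mem_set.
    by rewrite memNset.
apply: contrapT => /forallNP h.
have : (\sum_(c : X) (#|J|%:R * e)%:E < \sum_(c : X) P [set w | exists j, bad c j w])%E.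
  have fin c : P [set w | exists j, bad c j w] \is a fin_num by exact: fin_num_measure.
  rewrite [ltRHS](eq_bigr (fun c => (fine (P [set w | exists j, bad c j w]))%:E)); last first.
    by move=> c _; rewrite fineK.
  rewrite !sumEFin lte_fin; apply: ltr_sum => [|c _].
    by apply/hasP; exists c0 => //; rewrite mem_index_enum.
  by rewrite -lte_fin fineK// ltNge; apply/negP/h.
apply/negP; rewrite -leNgt.
apply: (@le_trans _ _ (\sum_(c : X) \sum_(j : J) P (bad c j))%E).
  by apply: lee_sum => c _; rewrite -bigsetU_fin; exact: Boole_seq.
rewrite exchange_big/=; apply: (@le_trans _ _ (\sum_(j : J) (#|X|%:R * e)%:E)%E).
  exact: lee_sum.
by rewrite !sumEFin lee_fin !sumr_const -[leLHS]mulr_natl -[leRHS]mulr_natl mulrCA.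
Qed.

(** * Cells, occupation and one random refinement *)

Definition unit_cell (R : realType) d (q x : 'I_d -> R) : Prop :=
  forall i, q i <= x i < q i + 1.

Lemma measurable_unit_cell (R : realType) d dV (V : measurableType dV)
    (x : V -> 'I_d -> R) (q : 'I_d -> R) :
  (forall i, measurable_fun setT (fun v => x v i)) ->
  measurable [set v | unit_cell q (x v)].
Proof.
move=> mx; rewrite (_ : [set _ | _] =
  \bigcap_(i in [set: 'I_d]) ((fun v => x v i) @^-1` `[q i, q i + 1[)).
  apply: fin_bigcap_measurable => // i _.
  by rewrite -[X in measurable X]setTI; exact: mx.
apply/seteqP; split => [v h i _|v h i]; first by rewrite /= in_itv/=; exact: h.
by have := h i I; rewrite /= in_itv.
Qed.

(** The local time of x in a unit cell.  Positions are rescaled by m^n at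
    level n, so that cells always have side 1. *)
Definition occupation (R : realType) d (x : R -> 'I_d -> R) (q : 'I_d -> R) : R :=
  fine (lebesgue_measure ([set` `[0, 1[] `&` [set v | unit_cell q (x v)])).

Definition slab (R : realType) (N : nat) (k : 'I_N.+1) : set R :=
  `[k%:R / N.+1%:R, k.+1%:R / N.+1%:R[.

(** The slabs are the atoms on which a function of the truncation of
    (N + 1) * v is constant; inord only serves to index them by 'I_N.+1. *)
Lemma slabP (R : realType) N (k : 'I_N.+1) (v : R) :
  slab k v <-> 0 <= v < 1 /\ inord (Num.truncn (N.+1%:R * v)) = k.
Proof.
rewrite /slab/= in_itv/= ler_pdivrMr// ltr_pdivlMr// mulrC; split.
  move=> /andP[h1 h2]; split.
    have N0 : 0 < N.+1%:R :> R by [].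
    apply/andP; split.
      by rewrite -(pmulr_rge0 _ N0); apply: le_trans h1.
    rewrite -(ltr_pM2l N0) mulr1; apply: lt_le_trans h2 _.
    by rewrite ler_nat.
  by rewrite (truncn_def (n := k)) ?h1// inord_val.
move=> [/andP[v0 v1] <-]; rewrite inordK ?truncn_itv ?mulr_ge0//.
by rewrite truncn_lt_nat ?mulr_ge0// gtr_pMr.
Qed.

Lemma slab_measurable (R : realType) N (k : 'I_N.+1) : measurable (slab k : set R).
Proof. exact: measurable_itv. Qed.

Lemma slab_measure (R : realType) N (k : 'I_N.+1) :
  lebesgue_measure (slab k : set R) = (N.+1%:R^-1)%:E.
Proof.
rewrite /slab lebesgue_measure_itv/= lte_fin ltr_pM2r ?invr_gt0//.
by rewrite ltr_nat ltnSn -EFinD -mulrBl -natrB// subSnn mul1r.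
Qed.

Lemma trivIset_slab (R : realType) N : trivIset setT (@slab R N).
Proof.
apply/trivIsetP => i j _ _ ij; apply/seteqP; split => // v [] /slabP[_ vi] /slabP[_ vj].
by move: ij; rewrite -vi -vj eqxx.
Qed.

Lemma fin_num_bigsum (R : realType) (I : finType) (F : I -> \bar R) :
  (forall i, F i \is a fin_num) -> (\sum_i F i)%E \is a fin_num.
Proof.
move=> hF; apply: (big_ind (fun z => z \is a fin_num)) => // z t hz ht.
by rewrite fin_numD hz.
Qed.

(** The picture is magnified by m at each step, so that displacements, which
    are multiples of m^-(n + 1) in the original scale, become integers. *)
Definition refine (R : realType) d m N
  (xi : {ffun 'I_N.+1 -> {ffun 'I_d -> 'I_(m.*2)}}) (x : R -> 'I_d -> R)
  (v : R) (i : 'I_d) : R :=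
  m%:R * x v i + (xi (inord (Num.truncn (N.+1%:R * v))) i)%:R - m%:R.

Lemma measurable_fun_truncn (R : realType) (N : nat) (h : nat -> R) :
  measurable_fun [set: R] (fun v => h (Num.truncn (N%:R * v))).
Proof.
move=> _ Y mY; rewrite setTI.
pose t (v : R) : R := (Num.truncn (N%:R * v))%:R.
have mt : measurable_fun [set: R] t.
  apply: nondecreasing_measurable => // u v uv; rewrite ler_nat.
  by apply: le_truncn; rewrite ler_wpM2l.
rewrite (_ : _ @^-1` _ = \bigcup_(k in [set k | Y (h k)]) (t @^-1` [set k%:R])).
  apply: bigcup_measurable => k _; rewrite -[X in measurable X]setTI.
  exact: mt.
apply/seteqP; split => [v Yv|v [k Yk /eqP]]; first by exists (Num.truncn (N%:R * v)).
by rewrite /t eqr_nat => /eqP vk; rewrite /preimage/= vk.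
Qed.

Definition child_cell (R : realType) d (m : nat) (q q' : 'I_d -> R) :=
  forall i, m%:R * q i <= q' i /\ q' i + 1 <= m%:R * (q i + 1).

Section step.
Variables (R : realType) (d m N : nat).
Hypothesis m_gt0 : (0 < m)%N.
Local Notation X := {ffun 'I_d -> 'I_(m.*2)}.
Local Notation mu := (@lebesgue_measure R).

(** The range {- m, ..., m - 1} of displacements is wide enough to bring any
    point of a magnified cell into any prescribed child. *)
Lemma shift_into (x q q' : 'I_d -> R) : unit_cell q x -> child_cell m q q' ->
  exists s : X, unit_cell q' (fun i => m%:R * x i + (s i)%:R - m%:R).
Proof.
move=> xq qq'.
have m0 : 0 < m%:R :> R by rewrite ltr0n.
pose t i := Num.truncn (m%:R + m%:R * x i - q' i).
have tP i : (t i)%:R <= m%:R + m%:R * x i - q' i < (t i).+1%:R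
    /\ (0 < t i <= m.*2)%N.
  have [q1 q2] := qq' i; have /andP[x1 x2] := xq i.
  have x1' : m%:R * q i <= m%:R * x i by rewrite ler_pM2l.
  have x2' : m%:R * x i < m%:R * (q i + 1) by rewrite ltr_pM2l.
  rewrite mulrDr mulr1 in q2 x2'.
  have z0 : 1 <= m%:R + m%:R * x i - q' i by lra.
  split; first by apply: truncn_itv; lra.
  rewrite truncn_gt0 z0/= truncn_le_nat -addn1 -muln2 natrD natrM; lra.
have ltt i : (m.*2 - t i < m.*2)%N.
  by have [_ /andP[t0 _]] := tP i; lia.
exists [ffun i => Ordinal (ltt i)] => i; rewrite ffunE/=.
have [/andP[h1 h2] /andP[_ tm]] := tP i.
rewrite natrB// -muln2 natrM.
by rewrite -natr1 in h2; apply/andP; split; lra.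
Qed.

Lemma fin_num_occ (A : set R) : measurable A ->
  mu ([set` `[0, 1[] `&` A) \is a fin_num.
Proof.
move=> mA; rewrite ge0_fin_numE//.
apply: (@le_lt_trans _ _ (mu (`[0, 1[ : set R))).
  by apply: le_measure; rewrite ?inE//; exact: measurableI.
by rewrite lebesgue_measure_itv/= lte_fin ltr01 -EFinD ltry.
Qed.

(** Let a k s be the mass of the part of the slab k that the displacement s
    sends into the child.  By shift_into these masses add up to at least c,
    each is at most 1 / (N + 1), and the occupation of the child is at least
    \sum_k a k (xi k), so that chernoff applies. *)
Lemma refine_chernoff (x : R -> 'I_d -> R) (q q' : 'I_d -> R) (c : R) :
  (forall i, measurable_fun setT (fun v => x v i)) -> child_cell m q q' ->
  c <= occupation x q ->
  #|[pred xi : {ffun 'I_N.+1 -> X} | occupation (refine xi x) q' < c / (4 * #|{: X}|%:R)]|%:R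
    <= #|{ffun 'I_N.+1 -> X}|%:R * expR (- (c * N.+1%:R / (4 * #|{: X}|%:R))).
Proof.
move=> mx qq' cq.
pose Q (s : X) := [set v : R | unit_cell q' (fun i => m%:R * x v i + (s i)%:R - m%:R)].
have mQ s : measurable (Q s).
  apply: measurable_unit_cell => i; apply: measurable_funB => //.
  by apply: measurable_funD => //; apply: measurable_funM.
pose S (k : 'I_N.+1) s := slab k `&` Q s.
have mS k s : measurable (S k s) by apply: measurableI => //; exact: slab_measurable.
have Sw k s : (mu (S k s) <= (N.+1%:R^-1)%:E)%E.
  rewrite -(slab_measure R k); apply: le_measure; rewrite ?inE//.
  - exact: mS.
  - exact: slab_measurable.
  - exact: subIsetl.
have Sfin k s : mu (S k s) \is a fin_num.
  by rewrite ge0_fin_numE//; apply: le_lt_trans (Sw k s) _; rewrite ltry.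
pose a k s := fine (mu (S k s)).
have X0 : (0 < #|{: X}|)%N.
  by rewrite card_ffun !card_ord expn_gt0 double_gt0 m_gt0.
have mq : measurable [set v : R | unit_cell q (x v)] by exact: measurable_unit_cell.
have csum : c <= \sum_k \sum_s a k s.
  apply: le_trans cq _; rewrite -lee_fin fineK ?fin_num_occ//.
  under eq_bigr do rewrite sum_fine//.
  rewrite sum_fine => [|k _]; last exact: fin_num_bigsum.
  rewrite fineK; last by apply: fin_num_bigsum => k; exact: fin_num_bigsum.
  apply: (@le_trans _ _ (\sum_(k < N.+1) mu (\big[setU/set0]_s S k s))%E); last first.
    by apply: lee_sum => k _; apply: Boole_seq => s; exact: mS.
  apply: (@le_trans _ _ (mu (\big[setU/set0]_(k < N.+1) \big[setU/set0]_s S k s))); last first.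
    by apply: Boole_seq => k; apply: bigsetU_measurable => s _; exact: mS.
  apply: le_measure; rewrite ?inE.
  - exact: measurableI.
  - by apply: bigsetU_measurable => k _; apply: bigsetU_measurable => s _; exact: mS.
  move=> v [/=]; rewrite in_itv/= => v01 vq.
  have [s hs] := shift_into vq qq'.
  rewrite bigsetU_fin; exists (inord (Num.truncn (N.+1%:R * v))).
  by rewrite bigsetU_fin; exists s; split=> //; apply/slabP.
have a_itv k s : 0 <= a k s <= N.+1%:R^-1.
  by rewrite fine_ge0//= -lee_fin fineK.
have w0 : 0 < N.+1%:R^-1 :> R by rewrite invr_gt0.
have := chernoff w0 X0 a_itv csum.
have -> : c / (4 * #|{: X}|%:R * N.+1%:R^-1) = c * N.+1%:R / (4 * #|{: X}|%:R).
  by rewrite invfM invrK mulrA mulrAC.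
apply: le_trans; rewrite ler_nat.
apply: subset_leq_card; apply/fintype.subsetP => xi.
rewrite !inE; apply: le_lt_trans.
rewrite sum_fine//.
rewrite -(measure_bigsetU_ord mu predT)//; last first.
  by apply: trivIset_setIr; exact: trivIset_slab.
  by move=> k; exact: mS.
have mR : measurable [set v : R | unit_cell q' (refine xi x v)].
  apply: measurable_unit_cell => i; rewrite /refine.
  apply: measurable_funB => //.
  apply: measurable_funD; first exact: measurable_funM.
  exact: (measurable_fun_truncn N.+1 (fun k => (xi (inord k) i)%:R)).
have mU : measurable (\big[setU/set0]_(i < N.+1 | predT i) S i (xi i)).
  by apply: bigsetU_measurable => k _; exact: mS.
have sub : \big[setU/set0]_(i < N.+1 | predT i) S i (xi i) `<=`
    [set` `[0, 1[] `&` [set v | unit_cell q' (refine xi x v)].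
  rewrite bigsetU_fin => v [k [/slabP[v01 vk]]]; rewrite /Q/= => h; split.
    by rewrite /= in_itv.
  by move=> i; rewrite /refine vk; exact: h.
have le : (mu (\big[setU/set0]_(i < N.+1 | predT i) S i (xi i)) <=
    mu ([set` `[0%R, 1%R[] `&` [set v | unit_cell q' (refine xi x v)]))%E.
  apply: le_measure; rewrite ?inE.
  - exact: mU.
  - by apply: measurableI; [exact: measurable_itv|exact: mR].
  - exact: sub.
rewrite /occupation; apply: fine_le => //; last exact: fin_num_occ.
rewrite ge0_fin_numE//; apply: le_lt_trans le _.
by rewrite -ge0_fin_numE//; exact: fin_num_occ.
Qed.
End step.

(** * A deterministic choice of refinements *)

(** This is where Fubini enters: the occupation is the measure of a
    section of a measurable subset of R * T. *)
Lemma measurable_occupation (R : realType) d dT (T : measurableType dT)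
    (x : R -> T -> 'I_d -> R) (q : 'I_d -> R) :
  (forall i, measurable_fun setT (fun p : R * T => x p.1 p.2 i)) ->
  measurable_fun setT (fun w => occupation (x ^~ w) q).
Proof.
move=> mx; apply: measurableT_comp => //.
pose A := ([set` `[0%R, 1%R[] `*` setT) `&` [set p : R * T | unit_cell q (x p.1 p.2)].
have mA : measurable A.
  apply: measurableI; first by apply: measurableX => //; exact: measurable_itv.
  exact: measurable_unit_cell.
rewrite (_ : (fun w => _) = lebesgue_measure \o ysection A); last first.
  apply/funext => w /=; congr lebesgue_measure.
  apply/seteqP; split=> v; rewrite /ysection/= inE /A/=; first by case.
  by case=> -[].
exact: (measurable_fun_ysection lebesgue_measure mA).
Qed.

Definition region (d L : nat) := {ffun 'I_d -> 'I_L.*2.+1}.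

(** Corners of the cells of a box around the origin, of half-side L in
    rescaled coordinates. *)
Definition corner (R : realType) d L (z : region d L) (i : 'I_d) : R := (z i)%:R - L%:R.

Section refinements.
Variables (R : realType) (dT : measure_display) (T : measurableType dT).
Variables (P : probability T R) (d m : nat) (m_gt0 : (0 < m)%N).
Variable y : R -> T -> 'I_d -> R.
Hypothesis my : forall i, measurable_fun setT (fun p : R * T => y p.1 p.2 i).
Local Notation X := {ffun 'I_d -> 'I_(m.*2)}.

Definition position n (K : R -> 'I_d -> R) (w : T) (v : R) (i : 'I_d) : R :=
  K v i + m%:R ^+ n * y v w i.

Definition nshifts : nat := #|{: X}|.
(** A child is expected to receive the fraction 1 / nshifts of the
    occupation of its parent; the factor 4 is the loss conceded in
    refine_chernoff. *)
Definition threshold n : R := (4 * nshifts%:R) ^- n.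
(** The predecessor is there because displacements are indexed by
    'I_(npieces n).+1: the number of slabs is (8 * nshifts) ^ n.+1. *)
Definition npieces n : nat := ((8 * nshifts) ^ n.+1).-1.
(** In the original scale the box has half-side 2 ^ n, which tends to
    infinity and so ends up containing any bounded path. *)
Definition box_radius n : nat := ((m.*2) ^ n)%N.

Lemma nshiftsE : nshifts = (m.*2 ^ d)%N.
Proof. by rewrite /nshifts card_ffun !card_ord. Qed.

Lemma nshifts_gt0 : (0 < nshifts)%N.
Proof. by rewrite nshiftsE expn_gt0 double_gt0 m_gt0. Qed.

Lemma npiecesE n : (npieces n).+1 = ((8 * nshifts) ^ n.+1)%N.
Proof. by rewrite prednK// expn_gt0 muln_gt0 nshifts_gt0. Qed.

Lemma refine_position n N (xi : {ffun 'I_N.+1 -> X}) K w :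
  refine xi (position n K w) = position n.+1 (refine xi K) w.
Proof. by apply/funext => v; apply/funext => i; rewrite /refine /position exprS; ring. Qed.

Definition drops n (K : R -> 'I_d -> R) (xi : {ffun 'I_(npieces n).+1 -> X})
    (j : region d (box_radius n) * region d (box_radius n.+1)) : set T :=
  [set w | [/\ child_cell m (corner R j.1) (corner R j.2),
    threshold n <= occupation (position n K w) (corner R j.1) &
    occupation (position n.+1 (refine xi K) w) (corner R j.2) < threshold n.+1]].

Definition measurable_state (K : R -> 'I_d -> R) :=
  forall i, measurable_fun setT (fun v => K v i).

Lemma measurable_refine N (xi : {ffun 'I_N.+1 -> X}) K :
  measurable_state K -> measurable_state (refine xi K).
Proof.
move=> mK i; apply: measurable_funB => //.
apply: measurable_funD; first exact: measurable_funM.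
exact: (measurable_fun_truncn N.+1 (fun k => (xi (inord k) i)%:R)).
Qed.

Lemma measurable_position n K w : measurable_state K -> measurable_state (position n K w).
Proof.
move=> mK i; apply: measurable_funD => //; apply: measurable_funM => //.
exact: (measurableT_comp (my i) (measurable_pair2 _)).
Qed.

Lemma measurable_occ_position n K q : measurable_state K ->
  measurable_fun setT (fun w => occupation (position n K w) q).
Proof.
move=> mK.
apply: (measurable_occupation (x := fun v w => position n K w v)) => i.
apply: measurable_funD; last exact: measurable_funM.
exact: (measurableT_comp (mK i)).
Qed.

Lemma measurable_drops (n : nat) K (xi : {ffun 'I_(npieces n).+1 -> X}) j :
  measurable_state K -> measurable (drops K xi j).
Proof.
move=> mK; have mK' := measurable_refine xi mK.
have [ch|nch] := pselect (child_cell m (corner R j.1) (corner R j.2)); last first.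
  by rewrite (_ : drops _ _ _ = set0)//; apply/seteqP; split => w // [].
rewrite (_ : drops _ _ _ =
  ((fun w => occupation (position n K w) (corner R j.1)) @^-1` `[threshold n, +oo[) `&`
  ((fun w => occupation (position n.+1 (refine xi K) w) (corner R j.2))
     @^-1` `]-oo, threshold n.+1[)).
  apply: measurableI; rewrite -[X in measurable X]setTI;
    by apply: measurable_occ_position => //; exact: measurable_itv.
apply/seteqP; split => w; rewrite /drops/= !in_itv/= andbT; first by case.
by case.
Qed.

(** The exponent is threshold n * b ^ n.+1 / (4 * nshifts) with
    b = 8 * nshifts, that is 2 ^ n.+1. *)
Lemma exists_refinement n K : measurable_state K ->
  exists xi, (P [set w | exists j, @drops n K xi j w]
    <= (#|{: region d (box_radius n) * region d (box_radius n.+1)}|%:R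
        * expR (- (2 ^+ n.+1)))%:E)%E.
Proof.
move=> mK.
have D0 : (0 < nshifts%:R :> R) by rewrite ltr0n nshifts_gt0.
apply: small_union_of_small_average.
- by rewrite card_ffun expn_gt0 nshifts_gt0.
- by move=> xi j; exact: measurable_drops.
move=> [q q'] w.
have [ch|nch] := pselect (child_cell m (corner R q) (corner R q')); last first.
  rewrite (@eq_card0 _ [pred _ | _]) => [|xi].
    by rewrite mulr_ge0// expR_ge0.
  by rewrite !inE; apply/asboolP => -[].
have [le|nle] := pselect (threshold n <= occupation (position n K w) (corner R q)); last first.
  rewrite (@eq_card0 _ [pred _ | _]) => [|xi].
    by rewrite mulr_ge0// expR_ge0.
  by rewrite !inE; apply/asboolP => -[].
have := refine_chernoff (npieces n) m_gt0 (measurable_position n w mK) ch le.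
rewrite -/nshifts.
have -> : threshold n * (npieces n).+1%:R / (4 * nshifts%:R) = 2 ^+ n.+1.
  rewrite npiecesE natrX natrM /threshold.
  have -> : 8 * nshifts%:R = 2 * (4 * nshifts%:R) :> R by ring.
  have G0 : 4 * nshifts%:R != 0 :> R by rewrite mulf_neq0// gt_eqF.
  move: (4 * nshifts%:R) G0 => G G0.
  by rewrite exprMn [G ^+ n.+1]exprSr mulrCA mulKf ?expf_neq0// mulfK.
apply: le_trans; rewrite ler_nat.
apply: subset_leq_card; apply/fintype.subsetP => xi.
rewrite !inE => -[_ _ h]; move: h.
by rewrite refine_position /threshold exprSr invfM.
Qed.

Fixpoint state (xi : forall n, {ffun 'I_(npieces n).+1 -> X}) (n : nat) : R -> 'I_d -> R :=
  if n is k.+1 then refine (xi k) (state xi k) else fun _ _ => 0.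

Lemma measurable_state_state xi n : measurable_state (state xi n).
Proof. by elim: n => [|n IH] /=; [move=> i|exact: measurable_refine]. Qed.

(** The choice at level n depends on the state reached there, so choices and
    states are built by one recursion. *)
Lemma exists_state : exists xi, forall n,
  (P [set w | exists j, drops (state xi n) (xi n) j w]
    <= (#|{: region d (box_radius n) * region d (box_radius n.+1)}|%:R
        * expR (- (2 ^+ n.+1)))%:E)%E.
Proof.
have F n K : {xi | measurable_state K -> (P [set w | exists j, @drops n K xi j w]
    <= (#|{: region d (box_radius n) * region d (box_radius n.+1)}|%:R
        * expR (- (2 ^+ n.+1)))%:E)%E}.
  apply: cid; have [mK|nmK] := pselect (measurable_state K).
    by have [xi h] := exists_refinement n mK; exists xi.
  have [|xi _] := @exists_refinement n (fun _ _ => 0); first by move=> i.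
  by exists xi => mK.
pose K := fix K n : R -> 'I_d -> R :=
  if n is k.+1 then refine (sval (F k (K k))) (K k) else fun _ _ => 0.
pose xi n := sval (F n (K n)).
have KE n : state xi n = K n by elim: n => //= n ->.
exists xi => n; rewrite KE.
by apply: (svalP (F n (K n))); rewrite -KE; exact: measurable_state_state.
Qed.

End refinements.

(** Double exponential decay beats any geometric growth: apply
    t <= exp t to t = 2 ^ k / p, then raise to the power p and use p <= 2 ^ p. *)
Lemma expRN_exp2_le (R : realType) (p k : nat) : (0 < p)%N ->
  p%:R ^+ k * expR (- 2 ^+ k) <= p%:R ^+ p :> R.
Proof.
move=> p0; have p0' : 0 < p%:R :> R by rewrite ltr0n.
rewrite expRN ler_pdivrMr ?expR_gt0//.
have -> : expR (2 ^+ k) = expR (2 ^+ k / p%:R) ^+ p :> R.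
  by rewrite -expRM_natl mulrC divfK ?gt_eqF.
rewrite -exprMn.
have h : 2 ^+ k <= p%:R * expR (2 ^+ k / p%:R) :> R.
  rewrite mulrC -ler_pdivrMr//; apply: le_trans (expR_ge1Dx _); lra.
apply: (@le_trans _ _ ((2 ^+ k) ^+ p)); last first.
  by apply: lerXn2r h; rewrite nnegrE// mulr_ge0// expR_ge0.
rewrite -exprM mulnC exprM; apply: lerXn2r; rewrite ?nnegrE//.
by rewrite -natrX ler_nat ltnW// ltn_expl.
Qed.

Lemma card_region_le d L : (0 < L)%N -> (#|{: region d L}| <= (3 * L) ^ d)%N.
Proof.
move=> L0; rewrite card_ffun !card_ord.
by case: d => // d; rewrite leq_exp2r//; lia.
Qed.

Lemma card_region_pairs_le d m n : (0 < m)%N ->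
  (#|{: region d (box_radius m n) * region d (box_radius m n.+1)}|
     <= (((6 * m) ^ (3 * d)).+1 ^ n.+1))%N.
Proof.
move=> m0.
have radius0 k : (0 < box_radius m k)%N by rewrite expn_gt0 double_gt0 m0.
have h k j : (k < j)%N -> (#|{: region d (box_radius m k)}| <= (6 * m) ^ (d * j))%N.
  move=> kj; apply: leq_trans (card_region_le d (radius0 k)) _.
  rewrite [X in (_ <= _ ^ X)%N]mulnC expnM; case: (d) => // d'; rewrite leq_exp2r//.
  rewrite /box_radius (leq_trans _ (leq_pexp2l (n1 := k.+1) _ kj))//; last by lia.
  rewrite expnS leq_mul//; first by lia.
  by case: (k) => // k'; rewrite leq_exp2r//; lia.
rewrite card_prod; apply: leq_trans (leq_mul (h n n.+1 _) (h n.+1 n.+2 _)) _ => //.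
rewrite -expnD; apply: (@leq_trans (((6 * m) ^ (3 * d)) ^ n.+1)%N); last first.
  by rewrite leq_exp2r.
by rewrite -expnM leq_pexp2l//; nia.
Qed.

(** * Almost every path fills a cell *)

Section filling.
Variables (R : realType) (dT : measure_display) (T : measurableType dT).
Variables (P : probability T R) (d m : nat) (m_gt1 : (1 < m)%N).
Variable y : R -> T -> 'I_d -> R.
Hypothesis my : forall i, measurable_fun setT (fun p : R * T => y p.1 p.2 i).

Local Notation SH :=
  (forall n, {ffun 'I_(npieces d m n).+1 -> {ffun 'I_d -> 'I_(m.*2)}}).

Let m_gt0 : (0 < m)%N := ltnW m_gt1.

(** Borel-Cantelli: the number of pairs of cells grows geometrically, and the
    probability of each bad event is doubly exponentially small. *)
Lemma eventually_no_drops : exists xi : SH,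
  {ae P, forall w, exists n0, forall n, (n0 <= n)%N -> forall j,
    ~ drops y (state xi n) (xi n) j w}.
Proof.
have [xi hxi] := exists_state P m_gt0 my.
exists xi.
pose bad n := [set w | exists j, drops y (state xi n) (xi n) j w].
have mbad n : measurable (bad n).
  rewrite /bad -bigsetU_fin; apply: bigsetU_measurable => j _.
  by apply: (measurable_drops my); exact: measurable_state_state.
pose p := (((6 * m) ^ (3 * d)).+1 * 2)%N.
have p0 : (0 < p)%N by rewrite muln_gt0.
have Pbad n : (P (bad n) <= ((p%:R ^+ p) / (2 ^ n.+1)%:R)%:E)%E.
  apply: le_trans (hxi n) _; rewrite lee_fin ler_pdivlMr ?ltr0n ?expn_gt0//.
  apply: le_trans (expRN_exp2_le _ n.+1 p0).
  rewrite mulrAC ler_wpM2r ?expR_ge0// /p natrM exprMn -!natrX -!natrM ler_nat.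
  by rewrite leq_mul// card_region_pairs_le.
exists (lim_sup_set bad); split.
- by apply: bigcapT_measurable => n; exact: bigcup_measurable.
- apply: lim_sup_set_cvg0 => //.
  apply: (@le_lt_trans _ _ (p%:R ^+ p)%:E); last by rewrite ltry.
  apply: le_trans (epsilon_trick0 xpredT _); last by rewrite exprn_ge0.
  by apply: lee_nneseries => // n _; exact: Pbad.
move=> w /= nw n _; apply: contrapT => nb; apply: nw; exists n => k nk j dr.
by apply: nb; exists k => //; exists j.
Qed.

(** The induction hypothesis needs the term - 2, since
    m * (2 * m ^ n - 2) + m <= 2 * m ^ n.+1 - 2 for m >= 2. *)
Lemma state_bound (xi : SH) n v i : `|state xi n v i : R| <= 2 * m%:R ^+ n - 2.
Proof.
have m2 : 2 <= m%:R :> R by rewrite ler_nat.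
elim: n => [|n IH] /=; first by rewrite normr0 expr0 mulr1 subrr.
rewrite /refine exprS; case: (xi n _ i) => s s_lt /=.
have s2 : s%:R <= 2 * m%:R - 1 :> R.
  by move: s_lt; rewrite -(ler_nat R) -addn1 natrD -mul2n natrM; lra.
have s0 : 0 <= s%:R :> R by [].
move: IH; rewrite !ler_norml => /andP[h1 h2].
have : m%:R * (state xi n v i) <= m%:R * (2 * m%:R ^+ n - 2) by rewrite ler_wpM2l.
have : m%:R * - (2 * m%:R ^+ n - 2) <= m%:R * (state xi n v i) by rewrite ler_wpM2l.
by move=> g1 g2; apply/andP; split; nra.
Qed.

(** Pigeonhole: the cells of the box cover all values, and the total mass
    is 1. *)
Lemma occupied_cell (x : R -> 'I_d -> R) (L : nat) :
  measurable_state x -> (forall v i, 0 <= v < 1 -> `|x v i| <= L%:R) ->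
  exists z : region d L, 1 <= #|{: region d L}|%:R * occupation x (corner R z).
Proof.
move=> mx xL; apply: contrapT => /forallNP h.
pose A (z : region d L) := [set` `[0, 1[] `&` [set v : R | unit_cell (corner R z) (x v)].
have mA z : measurable (A z).
  by apply: measurableI; [exact: measurable_itv|exact: measurable_unit_cell].
have N0 : 0 < #|{: region d L}|%:R :> R by rewrite ltr0n card_ffun expn_gt0 card_ord.
have : (lebesgue_measure (`[0%R, 1%R[ : set R) <= \sum_z lebesgue_measure (A z))%E.
  apply: (@le_trans _ _ (lebesgue_measure (\big[setU/set0]_z A z))); last first.
    by apply: Boole_seq => z; exact: mA.
  apply: le_measure; rewrite ?inE.
  - exact: measurable_itv.
  - by apply: bigsetU_measurable => z _; exact: mA.
  move=> v v01; have v01' : 0 <= v < 1 by move: v01; rewrite /= in_itv.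
  rewrite bigsetU_fin.
  have tlt i : 0 <= x v i + L%:R /\ (Num.truncn (x v i + L%:R) < L.*2.+1)%N.
    have := xL v i v01'; rewrite ler_norml => /andP[h1 h2].
    have h3 : 0 <= x v i + L%:R by lra.
    by split=> //; rewrite ltnS truncn_le_nat -natr1 -mul2n natrM; lra.
  exists [ffun i => Ordinal (tlt i).2]; split => // i; rewrite /corner ffunE/=.
  have [h3 _] := tlt i; have /andP[] := truncn_itv h3.
  by rewrite -natr1 => g1 g2; apply/andP; split; lra.
rewrite lebesgue_measure_itv/= lte_fin ltr01 -EFinD subr0.
apply/negP; rewrite -ltNge.
rewrite (eq_bigr (fun z => (occupation x (corner R z))%:E)); last first.
  by move=> z _; rewrite fineK//; apply: fin_num_occ; exact: measurable_unit_cell.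
rewrite sumEFin lte_fin.
apply: (@lt_le_trans _ _ (\sum_(z : region d L) #|{: region d L}|%:R^-1)).
  apply: ltr_sum => [|z _].
    apply/hasP; exists [ffun=> ord0]; first by rewrite mem_index_enum.
    by [].
  by have /negP := h z; rewrite -ltNge mulrC -ltr_pdivlMr// div1r.
by rewrite sumr_const -[leLHS]mulr_natl divff// gt_eqF.
Qed.

Lemma threshold_card n : (d <= n)%N ->
  threshold R d m n * #|{: region d (box_radius m n)}|%:R <= 1.
Proof.
move=> dn; rewrite mulrC ler_pdivrMr ?mul1r; last first.
  by rewrite exprn_gt0// mulr_gt0// ltr0n nshifts_gt0.
rewrite -natrM -natrX ler_nat nshiftsE.
apply: leq_trans (card_region_le _ _) _; first by rewrite expn_gt0 double_gt0 m_gt0.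
rewrite expnMn [leqRHS]expnMn leq_mul//; last by rewrite /box_radius -!expnM mulnC.
apply: (@leq_trans (4 ^ d)); first by case: (d) => // d'; rewrite leq_exp2r.
by rewrite leq_pexp2l.
Qed.

(** A box of radius 2 ^ n contains the path at level n and has at
    most (3 * (2m) ^ n) ^ d cells, which is below 1 / threshold n as soon as
    n >= d. *)
Lemma first_occupied_cell (xi : SH) w b :
  (forall v i, 0 <= v < 1 -> `|y v w i| <= b) ->
  exists n1, forall n, (n1 <= n)%N -> exists z : region d (box_radius m n),
    threshold R d m n <= occupation (position m y n (state xi n) w) (corner R z).
Proof.
(* State and path together are at most (2 + b) * m ^ n in rescaled coordinates. *)
move=> yb; exists (maxn d (Num.truncn (2 + b)).+1) => n; rewrite geq_max => /andP[dn bn].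
have m0 : 0 < m%:R ^+ n :> R by rewrite exprn_gt0// ltr0n.
have b2 : 2 + b <= 2 ^+ n.
  apply: ltW; apply: lt_le_trans (truncnS_gt _) _.
  by rewrite -natrX ler_nat; apply: leq_trans bn _; rewrite ltnW// ltn_expl.
have := @occupied_cell (position m y n (state xi n) w) (box_radius m n).
case=> [||z hz].
- by apply: measurable_position => //; exact: measurable_state_state.
- move=> v i v01; rewrite /position /box_radius -mul2n expnMn natrM.
  apply: le_trans (ler_normD _ _) _; rewrite normrM normrX normr_nat.
  have := state_bound xi n v i; have := yb v i v01 => h1 h2.
  have : m%:R ^+ n * `|y v w i| <= m%:R ^+ n * b by rewrite ler_wpM2l// ltW.
  have : m%:R ^+ n * (2 + b) <= m%:R ^+ n * 2 ^+ n by rewrite ler_wpM2l// ltW.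
  by rewrite !natrX; nra.
exists z; have N0 : 0 < #|{: region d (box_radius m n)}|%:R :> R.
  by rewrite ltr0n card_ffun expn_gt0 card_ord.
rewrite -(ler_pM2l N0); apply: le_trans hz.
by rewrite mulrC threshold_card.
Qed.

(** The point x stays fixed while its cell is refined: the cell of x at the
    next level is a child of the current one because corners are integers. *)
Lemma next_cell n (z : region d (box_radius m n)) (x : 'I_d -> R) :
  unit_cell (corner R z) (fun i => m%:R ^+ n * x i) ->
  exists z' : region d (box_radius m n.+1),
    unit_cell (corner R z') (fun i => m%:R ^+ n.+1 * x i) /\
    child_cell m (corner R z) (corner R z').
Proof.
move=> xz.
have m0 : 0 < m%:R :> R by rewrite ltr0n.
set L := box_radius m n in z xz *.
have LE : box_radius m n.+1 = (2 * m * L)%N by rewrite /box_radius expnS mul2n.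
pose u i := m%:R ^+ n.+1 * x i + (box_radius m n.+1)%:R.
have uE i : u i = m%:R * (m%:R ^+ n * x i) + 2 * m%:R * L%:R.
  by rewrite /u LE !natrM exprS mulrA.
have uz i : (m * z i + m * L)%:R <= u i < (m * z i + m * L + m)%:R.
  have := xz i; rewrite /corner => /andP[h1 h2].
  rewrite uE !natrD !natrM.
  have := ler_wpM2l (ltW m0) h1; have : m%:R * (m%:R ^+ n * x i) < m%:R * ((z i)%:R - L%:R + 1).
    by rewrite ltr_pM2l.
  by move=> g1 g2; apply/andP; split; nra.
have u0 i : 0 <= u i by have /andP[h _] := uz i; apply: le_trans h.
have tz i : (m * z i + m * L <= Num.truncn (u i) < m * z i + m * L + m)%N.
  by rewrite truncn_ge_nat// truncn_lt_nat//; exact: uz.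
have tlt i : (Num.truncn (u i) < (box_radius m n.+1).*2.+1)%N.
  have /andP[_ h] := tz i; apply: leq_trans h _.
  have : (z i <= L.*2)%N by rewrite -ltnS.
  have : (0 < L)%N by rewrite /L /box_radius expn_gt0 double_gt0 m_gt0.
  by rewrite LE; nia.
exists [ffun i => Ordinal (tlt i)]; split => i; rewrite /corner ffunE/=.
  by have /andP[] := truncn_itv (u0 i); rewrite -natr1 /u => h1 h2; apply/andP; split; lra.
have /andP[h1 h2] := tz i; split.
  move: h1; rewrite -(ler_nat R) natrD !natrM LE !natrM => h1; lra.
move: h2; rewrite -(ler_nat R) -addn1 !natrD !natrM LE !natrM => h2; lra.
Qed.

(** Start from an occupied cell at a level beyond which nothing drops.  Every
    descendant then has positive occupation, in particular it is not empty. *)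
Lemma fills_cell : exists xi : SH,
  {ae P, forall w, (exists b, forall v i, 0 <= v < 1 -> `|y v w i| <= b) ->
    exists n1 (q : 'I_d -> R), forall x,
      unit_cell q (fun i => m%:R ^+ n1 * x i) -> forall n, (n1 <= n)%N ->
      exists2 v, 0 <= v < 1 &
        forall i, `|state xi n v i / m%:R ^+ n + y v w i - x i| <= m%:R ^- n}.
Proof.
have [xi hxi] := eventually_no_drops; exists xi.
apply: filterS hxi => w [n0 hn0] [b yb].
have [n1 hn1] := first_occupied_cell xi yb.
pose n2 := maxn n0 n1.
have [|z0 hz0] := hn1 n2; first by rewrite leq_maxr.
exists n2, (corner R z0) => x xz0 n n2n.
have m0 : 0 < m%:R ^+ n :> R by rewrite exprn_gt0// ltr0n.
have [z xz hz] : exists2 z : region d (box_radius m n),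
    unit_cell (corner R z) (fun i => m%:R ^+ n * x i) &
    threshold R d m n <= occupation (position m y n (state xi n) w) (corner R z).
  elim: n n2n {m0} => [|n IH] n2n.
    by move: n2n z0 hz0 xz0; rewrite leqn0 => /eqP -> z0 hz0 xz0; exists z0.
  move: n2n; rewrite leq_eqVlt => /orP[/eqP n2E|n2n].
    by move: z0 hz0 xz0; rewrite n2E => z0 hz0 xz0; exists z0.
  have [z xz hz] := IH n2n.
  have [z' [xz' ch]] := next_cell xz.
  exists z' => //; rewrite leNgt; apply/negP => lt.
  apply: (hn0 n _ (z, z')); last by split.
  exact: leq_trans (leq_maxl n0 n1) n2n.
have t0 : 0 < threshold R d m n.
  by rewrite invr_gt0 exprn_gt0// mulr_gt0// ltr0n nshifts_gt0.
have [v v01 hv] : exists2 v, 0 <= v < 1 &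
    unit_cell (corner R z) (position m y n (state xi n) w v).
  apply: contrapT => h; move: (lt_le_trans t0 hz).
  rewrite /occupation (_ : _ `&` _ = set0) ?measure0 ?ltxx//.
  apply/seteqP; split => // v [/=]; rewrite in_itv/= => v01 vz.
  by apply: h; exists v.
exists v => // i.
have -> : state xi n v i / m%:R ^+ n + y v w i - x i =
    (position m y n (state xi n) w v i - m%:R ^+ n * x i) / m%:R ^+ n.
  by rewrite /position; field; rewrite gt_eqF// ltr0n.
rewrite normrM [X in _ * X]ger0_norm ?invr_ge0 ?(ltW m0)// ler_piMl ?invr_ge0 ?(ltW m0)//.
have /andP[h1 h2] := xz i; have /andP[h3 h4] := hv i.
by rewrite ler_norml; apply/andP; split; lra.
Qed.

End filling.

(** * Hausdorff content on the line as a distribution function *)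

Section content.
Variables (R : realType) (s delta : R).
Hypotheses (s_gt0 : 0 < s) (delta_gt0 : 0 < delta).
Local Open Scope ereal_scope.

Lemma diam_power_ge0 (U : set R) : 0 <= diam_power s U.
Proof. by rewrite /diam_power; case: ifP => // _; exact: poweR_ge0. Qed.

Lemma diameter_set0 : diameter (set0 : set R) = 0.
Proof.
rewrite /diameter set0X image_set0 ereal_sup0.
by apply/max_idPl; rewrite leNye.
Qed.

Lemma diam_power_set0 : diam_power s (set0 : set R) = 0.
Proof. by rewrite /diam_power eqxx. Qed.

Lemma diameter_itv (x y : R) : (x <= y)%R -> diameter `[x, y] <= (y - x)%:E.
Proof.
move=> xy; rewrite /diameter ge_max lee_fin subr_ge0 xy/=.
apply: ge_ereal_sup => _ [[p q] [/= + +] <-].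
rewrite !in_itv/= => /andP[p1 p2] /andP[q1 q2].
by rewrite lee_fin ler_norml; apply/andP; split; lra.
Qed.

Lemma diam_power_itv (x y : R) : (x <= y)%R ->
  diam_power s `[x, y] <= ((y - x) `^ s)%:E.
Proof.
move=> xy; rewrite /diam_power; case: ifP => [_|_]; first by rewrite lee_fin powR_ge0.
rewrite -poweR_EFin; apply: gt0_ler_poweR; first exact: ltW.
- by rewrite in_itv/= leey andbT /diameter le_max lexx.
- by rewrite in_itv/= leey andbT lee_fin subr_ge0.
- exact: diameter_itv.
Qed.

Lemma content_ge0 (A : set R) : 0 <= hausdorff_content s delta A.
Proof.
apply: le_ereal_inf_tmp => _ [U _ <-]; apply: nneseries_ge0 => n _ _.
exact: diam_power_ge0.
Qed.

Lemma content_le (A B : set R) : A `<=` B ->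
  hausdorff_content s delta A <= hausdorff_content s delta B.
Proof.
move=> AB; apply: ereal_inf_le_tmp => _ [U [BU dU] <-]; exists U => //.
by split => //; exact: subset_trans BU.
Qed.

Lemma content_set0 : hausdorff_content s delta set0 = 0.
Proof.
apply/eqP; rewrite eq_le content_ge0 andbT; apply: ereal_inf_lbound.
exists (fun=> set0); last by apply: eseries0 => n _ _; exact: diam_power_set0.
by split=> // i; rewrite diameter_set0 lee_fin ltW.
Qed.

(** Add the interval [x, y] to a cover of the part of A on the left of x. *)
Lemma content_add_itv (A : set R) (x y : R) : (x <= y)%R -> (y - x <= delta)%R ->
  hausdorff_content s delta (A `&` `]-oo, y]) <=
  hausdorff_content s delta (A `&` `]-oo, x]) + ((y - x) `^ s)%:E.
Proof.
move=> xy yx; rewrite -leeBlDr//; apply: le_ereal_inf_tmp => _ [U [AU dU] <-].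
rewrite leeBlDr//; pose V n := if n is k.+1 then U k else `[x, y]%classic.
apply: (@le_trans _ _ (\sum_(0 <= n <oo) diam_power s (V n))).
  apply: ereal_inf_lbound; exists V => //; split=> [z [Az]|[|n]//=]; last first.
    by apply: le_trans (diameter_itv xy) _; rewrite lee_fin.
  rewrite /= in_itv/= => zy; have [zx|xz] := leP z x.
    by have [|n _ Un] := AU z; [split => //; rewrite /= in_itv|exists n.+1].
  by exists 0%N => //=; rewrite in_itv/= zy ltW.
rewrite nneseries_recl//; last by move=> n _; exact: diam_power_ge0.
rewrite addeC -nneseries_addn; last by move=> n; exact: diam_power_ge0.
apply: leeD; last exact: diam_power_itv.
by apply: lee_nneseries => [n _ _|n _]; [exact: diam_power_ge0|rewrite addn1].
Qed.

End content.

Lemma content_gt0 (R : realType) (s : R) (A : set R) : 0 <= s ->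
  (s%:E < hausdorff_dim A)%E ->
  exists2 delta, 0 < delta & (0 < hausdorff_content s delta A)%E.
Proof.
move=> s0 sA; apply: contrapT => h.
have : (hausdorff_dim A <= s%:E)%E.
  apply: ereal_inf_lbound; exists s => //; split => //.
  apply/eqP; rewrite eq_le; apply/andP; split.
    apply: ge_ereal_sup => _ [delta /= delta0 <-]; rewrite leNgt; apply/negP => c0.
    by apply: h; exists delta.
  apply: le_ereal_sup_tmp; exists (hausdorff_content s 1 A); last exact: content_ge0.
  by exists 1 => //=.
by rewrite leNgt sA.
Qed.

Section distribution_function.
Variables (R : realType) (s delta : R) (A : set R).
Hypotheses (s_gt0 : 0 < s) (delta_gt0 : 0 < delta).
Hypotheses (A01 : A `<=` `[0, 1]) (Aclosed : closed A).
Hypothesis content_A : (0 < hausdorff_content s delta A)%E.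

Local Notation G x := (hausdorff_content s delta (A `&` `]-oo, x])).

Lemma contentN1 : G (-1) = 0%E.
Proof.
rewrite (_ : _ `&` _ = set0) ?content_set0//.
apply/seteqP; split => // z [/A01]; rewrite /= !in_itv/=; lra.
Qed.

Lemma content_fin_num x : G x \is a fin_num.
Proof.
rewrite ge0_fin_numE ?content_ge0//.
have fin k : (G (-1 + k%:R * delta)%R < +oo)%E.
  elim: k => [|k IH]; first by rewrite mul0r addr0 contentN1 ltry.
  have h1 : -1 + k%:R * delta <= -1 + k.+1%:R * delta.
    by rewrite lerD2l ler_pM2r// ler_nat.
  have h2 : (-1 + k.+1%:R * delta) - (-1 + k%:R * delta) <= delta.
    by rewrite -natr1 mulrDl mul1r; lra.
  apply: le_lt_trans (content_add_itv s_gt0 A h1 h2) _.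
  by rewrite lte_add_pinfty// ltry.
apply: le_lt_trans (fin (Num.truncn ((x + 1) / delta)).+1).
apply: content_le; apply: setIS => z /=; rewrite !in_itv/= => zx.
have := truncnS_gt ((x + 1) / delta); rewrite ltr_pdivrMr//; lra.
Qed.

(** The distribution function of a Frostman measure on A, obtained without
    constructing the measure. *)
Definition cdf (x : R) : R := fine (G x).

Lemma cdf_le x y : x <= y -> cdf x <= cdf y.
Proof.
move=> xy; apply: fine_le; rewrite ?content_fin_num//; apply: content_le.
by apply: setIS => z /=; rewrite !in_itv/= => /le_trans; apply.
Qed.

Lemma cdfN1 : cdf (-1) = 0. Proof. by rewrite /cdf contentN1. Qed.

Lemma cdf_ge0 x : 0 <= cdf x.
Proof. exact/fine_ge0/content_ge0. Qed.

Lemma content_total : G 1 = hausdorff_content s delta A.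
Proof.
congr hausdorff_content; apply/seteqP; split => z; first by case.
by move=> Az; split => //; have := A01 Az; rewrite /= !in_itv/=; lra.
Qed.

Lemma cdf1_gt0 : 0 < cdf 1.
Proof. by rewrite -lte_fin fineK ?content_fin_num// content_total. Qed.

Lemma cdf_le_cdf1 x : cdf x <= cdf 1.
Proof.
apply: fine_le; rewrite ?content_fin_num//; rewrite content_total.
by apply: content_le => z [].
Qed.

Lemma cdf_hoelder_local x y : x <= y -> y - x <= delta ->
  cdf y - cdf x <= (y - x) `^ s.
Proof.
move=> xy yx; rewrite lerBlDl -lee_fin EFinD !fineK ?content_fin_num//.
exact: content_add_itv.
Qed.

Definition cdf_const : R := 1 + cdf 1 / delta `^ s.

Lemma cdf_const_gt0 : 0 < cdf_const.
Proof. by rewrite ltr_wpDr// divr_ge0 ?cdf_ge0// powR_ge0. Qed.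

(** The local bound fails at distances larger than delta; there the total
    mass cdf 1 is absorbed in the constant. *)
Lemma cdf_hoelder x y : x <= y -> cdf y - cdf x <= cdf_const * (y - x) `^ s.
Proof.
move=> xy; have d0 : 0 < delta `^ s by rewrite powR_gt0.
have [yx|yx] := leP (y - x) delta.
  apply: le_trans (cdf_hoelder_local xy yx) _.
  by rewrite ler_peMl ?powR_ge0// lerDl divr_ge0 ?cdf_ge0// ltW.
apply: (@le_trans _ _ (cdf 1)).
  by have := cdf_le_cdf1 y; have := cdf_ge0 x; lra.
have h : delta `^ s <= (y - x) `^ s.
  by rewrite ge0_ler_powR// ?nnegrE ?ltW// (lt_trans delta_gt0).
apply: (@le_trans _ _ (cdf 1 / delta `^ s * (y - x) `^ s)).
  by rewrite mulrAC ler_pdivlMr// ler_wpM2l// cdf_ge0.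
by rewrite ler_wpM2r ?powR_ge0// lerDr.
Qed.

Lemma cdf_continuous : continuous cdf.
Proof.
have C0 := cdf_const_gt0.
move=> x; apply/cvgrPdist_le => e e0.
have e1 : 0 < (e / cdf_const) `^ s^-1 by rewrite powR_gt0// divr_gt0.
near=> t.
have xt : `|x - t| <= (e / cdf_const) `^ s^-1.
  by near: t; exact: cvgr_dist_le.
have key u v : u <= v -> v - u <= (e / cdf_const) `^ s^-1 -> cdf v - cdf u <= e.
  move=> uv vu; apply: le_trans (cdf_hoelder uv) _.
  rewrite mulrC -ler_pdivlMr//.
  have -> : e / cdf_const = ((e / cdf_const) `^ s^-1) `^ s.
    by rewrite -powRrM mulVf ?gt_eqF// powRr1// divr_ge0// ltW.
  by rewrite ge0_ler_powR// ?nnegrE ?subr_ge0// ltW.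
have [h|h] := leP x t.
  rewrite ler0_norm ?subr_le0 ?cdf_le// opprB; apply: key => //.
  by rewrite -opprB -ler0_norm// subr_le0.
rewrite ger0_norm ?subr_ge0 ?cdf_le ?(ltW h)//; apply: key; first exact: ltW.
by rewrite -[X in X <= _]ger0_norm// subr_ge0 ltW.
Unshelve. all: by end_near. Qed.

(** A preimage x of u exists by the intermediate value theorem; moving it
    left to the last point of A before x does not change the content. *)
Lemma cdf_onto u : 0 < u <= cdf 1 -> exists2 x, A x & cdf x = u.
Proof.
move=> /andP[u0 u1].
have [x _ xu] : exists2 x, x \in `[(-1 : R), 1] & cdf x = u.
  apply: IVT; first lra.
    exact/continuous_subspaceT/cdf_continuous.
  by rewrite cdfN1 (min_idPl (ltW cdf1_gt0)) (max_idPr (ltW cdf1_gt0)) (ltW u0).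
pose D := A `&` `]-oo, x].
have D0 : D !=set0.
  apply/set0P/eqP => D0; move: u0; rewrite -xu /cdf -/D D0 content_set0//=.
  by rewrite ltxx.
have ubD : ubound D x by move=> z [_]; rewrite /= in_itv.
have Dclosed : closed D.
  by apply: closedI => //; exact: lray_closed.
have Dsup : D (sup D).
  apply: itv_closed_supremums => //; split.
    by apply/ub_le_sup; exists x.
  by move=> z zD; exact: ge_sup.
exists (sup D); first by case: Dsup.
rewrite -xu; congr (fine (hausdorff_content _ _ _)).
apply/seteqP; split => z [Az zx]; split => //.
  have [_] := Dsup; move: zx; rewrite /= !in_itv/=; exact: le_trans.
rewrite /= in_itv/=; apply: ub_le_sup; first by exists x.
by split.
Qed.

End distribution_function.

(** Frostman's lemma on the line in inverse form: the Hoelder bound on the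
    distribution function says that its inverse tau separates points. *)
Lemma inverse_distribution_function (R : realType) (s : R) (A : set R) :
  0 < s -> A `<=` `[0, 1] -> closed A -> (s%:E < hausdorff_dim A)%E ->
  exists M C (tau : R -> R), [/\ 0 < M, 0 < C,
    forall u, 0 < u <= M -> A (tau u) &
    forall u v, 0 < u -> u <= v -> v <= M ->
      tau u <= tau v /\ v - u <= C * (tau v - tau u) `^ s].
Proof.
move=> s0 A01 Acl sA.
have [delta d0 cA] := content_gt0 (ltW s0) sA.
pose F := cdf s delta A.
have [tau htau] : {tau : R -> R & forall u, 0 < u <= F 1 -> A (tau u) /\ F (tau u) = u}.
  apply: (@choice _ _ (fun u x => 0 < u <= F 1 -> A x /\ F x = u)) => u.
  have [h|h] := pselect (0 < u <= F 1); last by exists 0.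
  by have [x Ax Fx] := cdf_onto s0 d0 A01 Acl cA h; exists x.
exists (F 1), (cdf_const s delta A), tau; split.
- exact: cdf1_gt0.
- exact: cdf_const_gt0.
- by move=> u /htau[].
move=> u v u0 uv vM.
have [_ Fu'] : A (tau u) /\ F (tau u) = u by apply: htau; rewrite u0 (le_trans uv).
have [_ Fv'] : A (tau v) /\ F (tau v) = v by apply: htau; rewrite vM (lt_le_trans u0).
have tuv : tau u <= tau v.
  have [//|vu] := leP (tau u) (tau v).
  have := cdf_le s0 d0 A01 (ltW vu); rewrite -/F Fu' Fv' => vu'.
  have uv_eq : u = v by apply/eqP; rewrite eq_le uv.
  by move: vu; rewrite uv_eq ltxx.
by split=> //; rewrite -{1}Fu' -{1}Fv'; exact: cdf_hoelder.
Qed.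

(** * A Cantor parametrization of a subset of A *)

(** The intervals [u n - 2 m^-n, u n + 2 m^-n] are nested because
    1 + 2 / m <= 2, and their common point is the limit. *)
Lemma geometric_limit (R : realType) (m : R) (u : nat -> R) : 2 <= m ->
  (forall n, `|u n.+1 - u n| <= m ^- n) ->
  exists x, forall n, `|x - u n| <= 2 * m ^- n.
Proof.
move=> m2 hu; have m0 : 0 < m by lra.
pose lo n := u n - 2 * m ^- n; pose up n := u n + 2 * m ^- n.
have mS n : 2 * m ^- n.+1 <= m ^- n.
  by rewrite exprS invfM mulrA ler_piMl ?invr_ge0 ?exprn_ge0 ?(ltW m0)// ler_pdivrMr ?mul1r.
have lo_ndS n : lo n <= lo n.+1.
  by have := hu n; have := mS n; rewrite ler_norml /lo => ? /andP[? ?]; lra.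
have up_niS n : up n.+1 <= up n.
  by have := hu n; have := mS n; rewrite ler_norml /up => ? /andP[? ?]; lra.
have lo_nd := homo_leq (@lexx _ R) (@le_trans _ R) lo_ndS.
have up_ni : {homo up : j k / (j <= k)%N >-> k <= j}.
  by apply: homo_leq => [//|x y z xy yz|//]; exact: le_trans yz xy.
have lo_up j k : lo j <= up k.
  apply: (@le_trans _ _ (lo (maxn j k))); first by apply: lo_nd; rewrite leq_maxl.
  apply: (@le_trans _ _ (up (maxn j k))); last by apply: up_ni; rewrite leq_maxr.
  by have : 0 <= m ^- maxn j k by [rewrite invr_ge0 exprn_ge0 ?ltW]; rewrite /lo /up; lra.
exists (sup (range lo)) => n; rewrite ler_norml.
have h1 : lo n <= sup (range lo).
  by apply: ub_le_sup; [exists (up 0%N) => _ [k _ <-]|exists n].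
have h2 : sup (range lo) <= up n.
  by apply: ge_sup; [exists (lo 0%N); exists 0%N|move=> _ [k _ <-]].
by move: h1 h2; rewrite /lo /up => h1 h2; apply/andP; split; lra.
Qed.

Lemma le_of_le_add_geometric (R : realType) (a b : R) :
  (forall n, a <= b + 4 * 2 ^- n) -> a <= b.
Proof.
move=> h; apply/ler_addgt0Pr => e e0.
have := h (Num.truncn (4 / e)).+1; move/le_trans; apply; rewrite lerD2l.
rewrite ler_pdivrMr ?exprn_gt0// mulrC -ler_pdivrMr//.
apply: ltW; apply: lt_trans (truncnS_gt _) _.
by rewrite -natrX ltr_nat ltn_expl.
Qed.

(** The function \sum_n floor (b^n v) / (2b)^n: every term is nondecreasing,
    so the sum is, and the n-th term alone makes it jump by (2b)^-n between
    distinct b-adic intervals of order n.  The truncation at b^n bounds the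
    terms outside [0, 1]. *)
Lemma cantor_function (R : realType) (b : nat) : (1 < b)%N ->
  exists sigma : R -> R, [/\ forall v, `|sigma v| <= 2,
    {homo sigma : u v / u <= v} &
    forall n u v, 0 <= u < 1 -> 0 <= v < 1 ->
      (Num.truncn (b%:R ^+ n * u) < Num.truncn (b%:R ^+ n * v))%N ->
      (2 * b)%:R ^- n <= sigma v - sigma u].
Proof.
move=> b1; have b0 : 0 < b%:R :> R by rewrite ltr0n ltnW.
have bb0 n : 0 < (2 * b)%:R ^- n :> R.
  by rewrite invr_gt0 exprn_gt0// natrM mulr_gt0.
pose a n (v : R) : nat := minn (Num.truncn (b%:R ^+ n * v)) (b ^ n).
pose S n (v : R) : R := \sum_(k < n) (a k v)%:R * (2 * b)%:R ^- k.
have S_step v n : `|S n.+1 v - S n v| <= 2 ^- n.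
  rewrite /S big_ord_recr/= addrAC subrr add0r normrM ger0_norm//.
  rewrite (ger0_norm (ltW (bb0 n))) -natrX.
  rewrite ler_pdivrMr ?ltr0n ?expn_gt0 ?muln_gt0 ?(ltnW b1)//.
  rewrite expnMn natrM natrX mulKf ?expf_neq0// natrX -natrX ler_nat.
  exact: geq_minr.
have [sigma hs] := choice (fun v => geometric_limit (lexx 2) (S_step v)).
have a_homo k u v : u <= v -> (a k u <= a k v)%N.
  move=> uv; rewrite /a leq_min geq_minr andbT (leq_trans (geq_minl _ _))//.
  by apply: le_truncn; rewrite ler_wpM2l// exprn_ge0// ltW.
have S_homo n u v : u <= v -> S n u <= S n v.
  move=> uv; apply: ler_sum => k _; rewrite ler_wpM2r ?(ltW (bb0 k))// ler_nat.
  exact: a_homo.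
exists sigma; split.
- by move=> v; have := hs v 0%N; rewrite /S big_ord0 subr0 expr0 invr1 mulr1.
- move=> u v uv; apply: le_of_le_add_geometric => n.
  have := hs u n; have := hs v n; have := S_homo n u v uv.
  by rewrite !ler_norml => ? /andP[? ?] /andP[? ?]; lra.
move=> n u v /andP[u0 u1] /andP[v0 v1] nuv.
have uv : u <= v.
  rewrite leNgt; apply/negP => vu; move: nuv; apply/negP; rewrite -leqNgt.
  by apply: le_truncn; apply: ler_wpM2l; [by rewrite exprn_ge0|exact: ltW].
apply: le_of_le_add_geometric => N.
(* The jump of the n-th term shows in every partial sum of order beyond n. *)
pose N' := maxn N n.+1.
have N'N : 2 ^- N' <= 2 ^- N :> R.
  rewrite lef_pV2 ?posrE ?exprn_gt0// ler_eXn2l ?ltr1n//.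
  by rewrite leq_maxl.
have aE w : 0 <= w -> w < 1 -> a n w = Num.truncn (b%:R ^+ n * w).
  move=> w0 w1; apply/minn_idPl; rewrite truncn_le_nat -natr1 natrX.
  apply: (@le_lt_trans _ _ (b%:R ^+ n)); last by rewrite ltrDl.
  by rewrite ler_piMr ?exprn_ge0// ltW.
have SN' : (2 * b)%:R ^- n <= S N' v - S N' u.
  rewrite /S -sumrB.
  have nN' : (n < N')%N by rewrite leq_max ltnSn orbT.
  rewrite (bigD1 (Ordinal nN'))//= -mulrBl !aE//.
  rewrite -[leLHS]addr0 lerD//.
    rewrite ler_peMl ?(ltW (bb0 n))// -natrB ?(ltnW nuv)// ler1n subn_gt0//.
  apply: sumr_ge0 => k _; rewrite -mulrBl mulr_ge0 ?(ltW (bb0 k))// subr_ge0 ler_nat.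
  exact: a_homo.
have := hs u N'; have := hs v N'.
by rewrite !ler_norml => /andP[? ?] /andP[? ?]; lra.
Qed.

(** The values of the Cantor function are moved affinely into ]0, M], the
    domain on which the inverse distribution function is defined. *)
Lemma cantor_parametrization (R : realType) (s : R) (A : set R) (b : nat) :
  0 < s -> A `<=` `[0, 1] -> closed A -> (s%:E < hausdorff_dim A)%E -> (1 < b)%N ->
  exists C (T : R -> R), [/\ 0 < C, forall v, A (T v), {homo T : u v / u <= v} &
    forall n u v, 0 <= u < 1 -> 0 <= v < 1 ->
      Num.truncn (b%:R ^+ n * u) != Num.truncn (b%:R ^+ n * v) ->
      (2 * b)%:R ^- n <= C * `|T u - T v| `^ s].
Proof.
move=> s0 A01 Acl sA b1.
have [M [C [tau [M0 C0 Atau htau]]]] := inverse_distribution_function s0 A01 Acl sA.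
have [sigma [s2 sh sgap]] := cantor_function R b1.
pose w v := M * (1 / 2 + sigma v / 8).
have w_itv v : 0 < w v <= M.
  have := s2 v; rewrite ler_norml => /andP[h1 h2]; rewrite /w.
  by apply/andP; split; [apply: mulr_gt0 => //; lra|rewrite ger_pMr//; lra].
have w_homo : {homo w : u v / u <= v}.
  by move=> u v /sh uv; rewrite /w ler_pM2l//; lra.
exists (8 * C / M), (tau \o w); split.
- by rewrite divr_gt0// mulr_gt0.
- by move=> v; exact: Atau.
- move=> u v uv /=; have /andP[u0 _] := w_itv u; have /andP[_ v1] := w_itv v.
  by have [] := htau _ _ u0 (w_homo _ _ uv) v1.
move=> n; suff key u v : 0 <= u < 1 -> 0 <= v < 1 ->
    (Num.truncn (b%:R ^+ n * u) < Num.truncn (b%:R ^+ n * v))%N ->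
    (2 * b)%:R ^- n <= 8 * C / M * `|tau (w u) - tau (w v)| `^ s.
  move=> u v u01 v01; rewrite neq_ltn => /orP[uv|vu]; first exact: key.
  by rewrite distrC; exact: key.
move=> u01 v01 uv; have gap := sgap n u v u01 v01 uv.
have wuv : w u <= w v.
  apply: w_homo; rewrite leNgt; apply/negP => vu; move: uv; apply/negP.
  by rewrite -leqNgt; apply: le_truncn; apply: ler_wpM2l; [by rewrite exprn_ge0|exact: ltW].
have /andP[u0 _] := w_itv u; have /andP[_ v1] := w_itv v.
have [tuv h] := htau _ _ u0 wuv v1.
rewrite distrC ger0_norm ?subr_ge0//; apply: le_trans gap _.
rewrite mulrAC ler_pdivlMr// -[8 * C * _]mulrA.
have : w v - w u = M * (sigma v - sigma u) / 8 by rewrite /w; field.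
move: h; lra.
Qed.

(** * Hoelder regularity of the limit of the displacements *)

(** The left-hand side is a constant times m ^ (d * alpha / s), and
    d * alpha / s < 1. *)
Lemma subdivision_choice (R : realType) (alpha s : R) (d : nat) :
  0 < alpha -> 0 < s -> d%:R * alpha < s ->
  exists2 m, (1 < m)%N & (2 * (8 * nshifts d m))%:R `^ (alpha / s) <= m%:R :> R.
Proof.
move=> a0 s0 das; have as0 : 0 < alpha / s by rewrite divr_gt0.
pose th := d%:R * (alpha / s).
have th1 : th < 1 by rewrite /th mulrA ltr_pdivrMr// mul1r.
pose c : R := (2 * (8 * 2 ^ d))%:R `^ (alpha / s).
have c0 : 0 <= c by exact: powR_ge0.
pose t := c `^ (1 - th)^-1.
pose m := (Num.truncn t).+2.
exists m => //; rewrite nshiftsE -mul2n expnMn.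
have -> : (2 * (8 * (2 ^ d * m ^ d)))%:R = (2 * (8 * 2 ^ d))%:R * m%:R ^+ d :> R.
  by rewrite -natrX -natrM !mulnA.
rewrite powRM ?exprn_ge0// -/c -powR_mulrn// -powRrM -/th.
have m0 : 0 < m%:R :> R by [].
have h : c <= m%:R `^ (1 - th).
  have -> : c = t `^ (1 - th).
    by rewrite /t -powRrM mulVf ?powRr1// gt_eqF// subr_gt0.
  rewrite ge0_ler_powR ?subr_ge0 ?(ltW th1) ?nnegrE ?powR_ge0//.
  by apply: ltW; apply: lt_trans (truncnS_gt _) _; rewrite ltr_nat.
apply: le_trans (ler_wpM2r (powR_ge0 _ _) h) _.
by rewrite -powRD ?subrK ?powRr1// (gt_eqF m0) implybT.
Qed.

Section limit_function.
Variables (R : realType) (d m : nat) (m_gt1 : (1 < m)%N).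
Variable xi : forall n, {ffun 'I_(npieces d m n).+1 -> {ffun 'I_d -> 'I_(m.*2)}}.
Let b := (8 * nshifts d m)%N.
Let m_gt0 : (0 < m)%N := ltnW m_gt1.
Let m_gt0R : 0 < m%:R :> R. Proof. by rewrite ltr0n. Qed.

Lemma exists_limit : exists Phi : R -> 'I_d -> R, forall v i n,
  `|Phi v i - state xi n v i / m%:R ^+ n| <= 2 * m%:R ^- n.
Proof.
have m2 : 2 <= m%:R :> R by rewrite ler_nat.
have step (v : R) i n :
    `|state xi n.+1 v i / m%:R ^+ n.+1 - state xi n v i / m%:R ^+ n| <= m%:R ^- n.
  rewrite /= /refine; case: (xi n _ i) => k k_lt /=.
  have -> : (m%:R * state xi n v i + k%:R - m%:R) / m%:R ^+ n.+1 - state xi n v i / m%:R ^+ n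
      = (k%:R - m%:R) / m%:R * m%:R ^- n :> R.
    have mn0 : m%:R != 0 :> R by rewrite gt_eqF.
    have Pn0 : m%:R ^+ n != 0 :> R by rewrite expf_neq0.
    rewrite exprS; move: (m%:R ^+ n) Pn0 => Q Q0.
    by field; rewrite mn0 Q0.
  rewrite normrM [X in _ * X]ger0_norm ?invr_ge0 ?exprn_ge0//.
  rewrite ler_piMl ?invr_ge0 ?exprn_ge0// normrM normfV normr_nat ler_pdivrMr// mul1r.
  have kR : k%:R <= 2 * m%:R :> R by rewrite -natrM ler_nat mul2n ltnW.
  have k0 : 0 <= k%:R :> R by [].
  by rewrite ler_norml; apply/andP; split; lra.
have h vi := geometric_limit m2 (step vi.1 vi.2).
have [Phi hPhi] := choice h.
by exists (fun v i => Phi (v, i)) => v i n; exact: hPhi (v, i) n.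
Qed.

Lemma state_eq n u v :
  (forall k, (k <= n)%N -> Num.truncn (b%:R ^+ k * u : R) = Num.truncn (b%:R ^+ k * v)) ->
  state xi n u = state xi n v.
Proof.
elim: n => [//|n IH] uv /=; apply/funext => i.
have E : Num.truncn ((npieces d m n).+1%:R * u) = Num.truncn ((npieces d m n).+1%:R * v).
  by rewrite npiecesE// natrX uv.
rewrite /refine E IH// => k kn.
by apply: uv; rewrite (leq_trans kn).
Qed.

(** The level n at which u and v part: they share their b-adic interval up to
    order n and not at order n + 1. *)
Lemma separated_level (u v : R) : 0 <= u < 1 -> 0 <= v < 1 -> u != v ->
  exists n, (forall k, (k <= n)%N -> Num.truncn (b%:R ^+ k * u) = Num.truncn (b%:R ^+ k * v))
    /\ Num.truncn (b%:R ^+ n.+1 * u) != Num.truncn (b%:R ^+ n.+1 * v).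
Proof.
have b2 : (1 < b)%N by rewrite /b; have := nshifts_gt0 d m_gt0; lia.
move=> /andP[u0 u1] /andP[v0 v1] uv.
have ex : exists n, Num.truncn (b%:R ^+ n * u) != Num.truncn (b%:R ^+ n * v).
  have d0 : 0 < `|u - v| by rewrite normr_gt0 subr_eq0.
  exists (Num.truncn `|u - v|^-1).+1; apply/eqP; set n := _.+1 => E.
  have big : 1 < b%:R ^+ n * `|u - v|.
    rewrite -ltr_pdivrMr// mul1r -[ltRHS]natrX; apply: lt_trans (truncnS_gt _) _.
    by rewrite ltr_nat ltn_expl.
  have pu : 0 <= b%:R ^+ n * u by rewrite mulr_ge0// exprn_ge0.
  have pv : 0 <= b%:R ^+ n * v by rewrite mulr_ge0// exprn_ge0.
  have /andP[h1 h2] := truncn_itv pu; have /andP[h3 h4] := truncn_itv pv.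
  rewrite E -natr1 in h1 h2; rewrite -natr1 in h4.
  move: big; rewrite -[X in X * _](@ger0_norm _ (b%:R ^+ n)) ?exprn_ge0//.
  rewrite -normrM mulrBr ltNge => /negP; apply.
  by rewrite ler_norml; apply/andP; split; lra.
case: (ex_minnP ex) => -[|n] hn hmin.
  move: hn; rewrite !expr0 !mul1r.
  have tr0 (w : R) : 0 <= w -> w < 1 -> Num.truncn w = 0%N.
    by move=> w0 w1; apply: truncn_def; rewrite w0.
  by rewrite !tr0.
exists n; split=> // k kn; apply/eqP; rewrite -[_ == _]negbK; apply/negP => /hmin.
by rewrite leqNgt ltnS kn.
Qed.

(** If u and v part after order n, their images under Phi differ by O(m^-n)
    since the first n displacements agree, while tau u and tau v are at
    distance at least a constant times (2b)^(-n / s). *)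
Lemma limit_hoelder (alpha s C : R) (T : R -> R) (Phi : R -> 'I_d -> R) :
  0 < alpha -> 0 < s -> 0 < C -> (2 * b)%:R `^ (alpha / s) <= m%:R ->
  (forall n u v, 0 <= u < 1 -> 0 <= v < 1 ->
      Num.truncn (b%:R ^+ n * u) != Num.truncn (b%:R ^+ n * v) ->
      (2 * b)%:R ^- n <= C * `|T u - T v| `^ s) ->
  (forall v i n, `|Phi v i - state xi n v i / m%:R ^+ n| <= 2 * m%:R ^- n) ->
  forall u v i, 0 <= u < 1 -> 0 <= v < 1 ->
    `|Phi u i - Phi v i| <= 4 * m%:R * C `^ (alpha / s) * `|T u - T v| `^ alpha.
Proof.
move=> a0 s0 C0 hb hT hPhi u v i u01 v01.
have as0 : 0 < alpha / s by rewrite divr_gt0.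
have [->|uv] := eqVneq u v.
  by rewrite subrr normr0 !mulr_ge0// powR_ge0.
have [n [Euv Nuv]] := separated_level u01 v01 uv.
have dPhi : `|Phi u i - Phi v i| <= 4 * m%:R ^- n.
  have := hPhi u i n; have := hPhi v i n; rewrite (state_eq Euv) !ler_norml.
  by move=> /andP[? ?] /andP[? ?]; apply/andP; split; lra.
apply: le_trans dPhi _.
have -> : m%:R ^- n = m%:R * m%:R ^- n.+1 :> R.
  by rewrite exprS invfM mulVKf// gt_eqF.
rewrite [leLHS]mulrA -[leRHS]mulrA ler_pM2l ?mulr_gt0//.
have bb0 : 0 < (2 * b)%:R :> R.
  by rewrite ltr0n /b; have := nshifts_gt0 d m_gt0; lia.
apply: (@le_trans _ _ (((2 * b)%:R ^- n.+1) `^ (alpha / s))).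
  have -> : ((2 * b)%:R ^- n.+1) `^ (alpha / s) = (((2 * b)%:R `^ (alpha / s)) ^+ n.+1)^-1 :> R.
    by rewrite -!powR_invn ?powR_ge0 ?(ltW bb0)// -!powRrM mulrC.
  rewrite lef_pV2 ?posrE ?exprn_gt0 ?powR_gt0//.
  by apply: lerXn2r => //; rewrite nnegrE ?powR_ge0.
have -> : C `^ (alpha / s) * `|T u - T v| `^ alpha = (C * `|T u - T v| `^ s) `^ (alpha / s).
  by rewrite powRM ?(ltW C0) ?powR_ge0// -powRrM mulrCA mulfV ?mulr1// gt_eqF.
rewrite ge0_ler_powR// ?(ltW as0) ?nnegrE ?mulr_ge0 ?(ltW C0) ?powR_ge0 ?invr_ge0 ?exprn_ge0//.
exact: hT.
Qed.

End limit_function.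

(** Subadditivity of powers: z <= z ^ alpha on [0, 1], applied to
    z = x / (x + y) and z = y / (x + y). *)
Lemma powRD_le (R : realType) (alpha x y : R) : 0 < alpha <= 1 -> 0 <= x -> 0 <= y ->
  (x + y) `^ alpha <= x `^ alpha + y `^ alpha.
Proof.
move=> /andP[a0 a1] x0 y0.
have [xy0|xy0] := eqVneq (x + y) 0.
  by rewrite xy0 powR0 ?gt_eqF// addr_ge0// powR_ge0.
have s0 : 0 < x + y by rewrite lt_neqAle eq_sym xy0 addr_ge0.
have key z : 0 <= z -> z <= x + y -> z / (x + y) <= (z / (x + y)) `^ alpha.
  move=> z0 zs; have [->|zn0] := eqVneq z 0; first by rewrite mul0r powR_ge0.
  have t0 : 0 < z / (x + y) by rewrite divr_gt0// lt_neqAle eq_sym zn0.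
  have t1 : z / (x + y) <= 1 by rewrite ler_pdivrMr ?mul1r.
  rewrite -[leLHS]powRr1 ?(ltW t0)//.
  by rewrite ger_powR// t0.
have E z : 0 <= z -> z `^ alpha = (x + y) `^ alpha * (z / (x + y)) `^ alpha.
  by move=> z0; rewrite -powRM ?(ltW s0) ?divr_ge0 ?(ltW s0)// mulrCA mulfV ?mulr1.
rewrite (E x)// (E y)// -mulrDr ler_peMr ?powR_ge0//.
have h1 := key x x0; have h2 := key y y0.
have -> : 1 = x / (x + y) + y / (x + y) by rewrite -mulrDl mulfV.
by apply: lerD; [apply: h1|apply: h2]; lra.
Qed.

(** McShane's extension x |-> inf_v (g v + K |x - T v|^alpha), which works
    because |x - y|^alpha is a distance. *)
Lemma hoelder_extension (R : realType) (V : Type) (D : set V) (T g : V -> R) (alpha K : R) :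
  0 < alpha <= 1 -> 0 <= K -> D !=set0 ->
  (forall u v, D u -> D v -> `|g u - g v| <= K * `|T u - T v| `^ alpha) ->
  exists f : R -> R, (forall v, D v -> f (T v) = g v) /\
    forall x y, `|f x - f y| <= K * `|x - y| `^ alpha.
Proof.
move=> alpha01 K0 [v0 Dv0] hg.
pose E x := [set g v + K * `|x - T v| `^ alpha | v in D].
have tri (x y z : R) : K * `|x - z| `^ alpha <= K * `|x - y| `^ alpha + K * `|y - z| `^ alpha.
  rewrite -mulrDr ler_wpM2l//; apply: le_trans (powRD_le alpha01 _ _) => //.
  rewrite ge0_ler_powR ?nnegrE ?addr_ge0//; first by case/andP: alpha01 => /ltW.
  by rewrite -(subrKA y x) ler_normD.
have E0 x : E x !=set0 by exists (g v0 + K * `|x - T v0| `^ alpha); exists v0.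
have Elb x u : D u -> lbound (E x) (g u - K * `|T u - x| `^ alpha).
  move=> Du _ [v Dv <-]; have := hg u v Du Dv; rewrite ler_norml => /andP[_ h].
  have := tri (T u) x (T v); lra.
have hinf x : has_inf (E x) by split; [exact: E0|exists (g v0 - K * `|T v0 - x| `^ alpha); exact: Elb].
pose f x := inf (E x).
have half x y : f x - f y <= K * `|x - y| `^ alpha.
  rewrite lerBlDr addrC -lerBlDr; apply: lb_le_inf; first exact: E0.
  move=> _ [v Dv <-]; rewrite lerBlDr.
  apply: (@le_trans _ _ (g v + K * `|x - T v| `^ alpha)).
    by apply: ge_inf; [exact: (hinf x).2|exists v].
  have := tri x y (T v); lra.
exists f; split=> [v Dv|x y]; last first.
  rewrite ler_norml half andbT lerNl opprB distrC; exact: half.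
apply/eqP; rewrite eq_le; apply/andP; split.
  apply: ge_inf; first exact: (hinf _).2.
  exists v => //; rewrite subrr normr0 powR0 ?mulr0 ?addr0// gt_eqF//.
  by case/andP: alpha01.
apply: lb_le_inf; first exact: E0.
have := Elb (T v) v Dv; rewrite subrr normr0 powR0 ?mulr0 ?subr0// gt_eqF//.
by case/andP: alpha01.
Qed.

(** * Conclusion for fractional Brownian motion *)

Lemma rV_norm_le (R : realType) d (x : 'rV[R]_d) (e : R) : 0 <= e ->
  (forall i, `|x 0 i| <= e) -> `|x| <= e.
Proof.
move=> e0 xe; rewrite /Num.norm/= mx_normrE.
by apply: bigmax_le => // -[i j] _ /=; rewrite ord1.
Qed.

Lemma rV_coord_le_norm (R : realType) d (x : 'rV[R]_d) i : `|x 0 i| <= `|x|.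
Proof.
rewrite /Num.norm/= mx_normrE.
exact: (le_bigmax _ (fun ij : 'I_1 * 'I_d => `|x ij.1 ij.2|) (0, i)).
Qed.

(** Since the paths are continuous, X (tau v) w is the limit of X at the
    grid times floor (N tau v) / N, and these approximations are finite
    sums of products of a function of v and a function of w. *)
Lemma measurable_time_changed_process (R : realType) dT (T : measurableType dT)
    (X : R -> T -> R) (tau : R -> R) :
  (forall t, `[0, 1]%classic t -> measurable_fun setT (X t)) ->
  (forall w, {within `[0, 1], continuous (X ^~ w)}) ->
  (forall v, `[0, 1]%classic (tau v)) -> {homo tau : u v / u <= v} ->
  measurable_fun setT (fun p : R * T => X (tau p.1) p.2).
Proof.
move=> mX cX tau01 tau_homo.
have mtau : measurable_fun [set: R] tau by exact: nondecreasing_measurable.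
pose tr N (v : R) := Num.truncn (N.+1%:R * tau v).
have trN N v : (tr N v < N.+2)%N.
  have := tau01 v; rewrite /= in_itv/= => /andP[v0 v1].
  rewrite ltnS truncn_le_nat; apply: (@le_lt_trans _ _ N.+1%:R).
    by rewrite ler_piMr.
  by rewrite ltr_nat.
(* The cap at 1 keeps every grid time in [0, 1]. *)
pose Y N (p : R * T) := \sum_(k < N.+2) (tr N p.1 == k)%:R * X (Num.min (k%:R / N.+1%:R) 1) p.2.
have YE N p : Y N p = X (Num.min ((tr N p.1)%:R / N.+1%:R) 1) p.2.
  rewrite /Y (bigD1 (Ordinal (trN N p.1)))//= eqxx mul1r big1 ?addr0// => k kn.
  by rewrite (_ : _ == _ = false) ?mul0r//; apply: contra_neqF kn => /eqP kE; exact: val_inj.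
have itvk N k : `[0, 1]%classic (Num.min (k%:R / N.+1%:R) 1 : R).
  by rewrite /= in_itv/= le_min divr_ge0// ler01 ge_min lexx orbT.
apply: (measurable_fun_cvg (h := Y)) => [N|p _].
  apply: measurable_sum => k; apply: measurable_funM.
    have h := measurable_fun_truncn N.+1 (fun j => (j == k)%:R : R).
    exact: (measurableT_comp (measurableT_comp h mtau) measurable_fst).
  exact: (measurableT_comp (mX _ (itvk N k)) measurable_snd).
have [v0 v1] : 0 <= tau p.1 /\ tau p.1 <= 1.
  by have := tau01 p.1; rewrite /= in_itv/= => /andP.
rewrite (_ : Y ^~ p = (X ^~ p.2) \o (fun N => Num.min ((tr N p.1)%:R / N.+1%:R) 1)); last first.
  by apply/funext => N; exact: YE.
have /subspace_continuousP/(_ _ (tau01 p.1)) cXp := cX p.2.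
apply: cvg_comp cXp => U; rewrite /within/= => -[e /= e0 eU].
exists (Num.truncn e^-1) => // N /= eN; apply: eU => /=; last exact: itvk.
have N0 : 0 < N.+1%:R :> R by [].
have tN : 0 <= N.+1%:R * tau p.1 by rewrite mulr_ge0.
have /andP[h1 h2] := truncn_itv tN; rewrite -/(tr N p.1) in h1 h2.
rewrite -natr1 in h2.
have h3 : (tr N p.1)%:R / N.+1%:R <= tau p.1 by rewrite ler_pdivrMr// mulrC.
rewrite min_l ?(le_trans h3)// ger0_norm ?subr_ge0//.
have -> : tau p.1 - (tr N p.1)%:R / N.+1%:R = (N.+1%:R * tau p.1 - (tr N p.1)%:R) / N.+1%:R.
  by rewrite mulrBl mulrAC mulfV ?mul1r// gt_eqF.
rewrite ltr_pdivrMr//; apply: (@lt_trans _ _ 1); first by rewrite ltrBlDl; lra.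
rewrite -ltr_pdivrMl// mulr1; apply: lt_le_trans (truncnS_gt _) _.
by rewrite ler_nat.
Qed.

Lemma fbm_measurable (R : realType) dT (T : measurableType dT) (P : probability T R)
    (H : R) (X : R -> T -> R) t : is_real_fbm P H X -> `[0, 1]%classic t ->
  measurable_fun setT (X t).
Proof.
move=> [gX _ _] t01.
have [mX _] := gX 1%N (fun=> t) (fun=> 1) (fun=> t01).
by move: mX; congr measurable_fun; apply/funext => w; rewrite big_ord1 mul1r.
Qed.

Theorem theorem4p1 (R : realType) (disp : measure_display)
  (T : measurableType disp) (P : probability T R)
  (Pcomplete : measure_is_complete P)
  (d : nat) (d_ge1 : (1 <= d)%N) (H : R) (H01 : 0 < H < 1)
  (B : R -> T -> 'rV[R]_d) (fbmB : is_fbm P H B)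
  (A : set R) (A01 : A `<=` `[0, 1]) (Aclosed : closed A)
  (dimA_gt0 : (0 < hausdorff_dim A)%E)
  (dimA_le : (hausdorff_dim A <= (H * d%:R)%:E)%E) :
  forall alpha : R, 0 < alpha -> (alpha%:E < hausdorff_dim A / d%:R%:E)%E ->
  exists f : R -> 'rV[R]_d, hoelder_on `[0, 1] alpha f /\
    {ae P, forall w, interior [set B t w + f t | t in A] !=set0}.
Proof.
move=> alpha alpha0 alphaA.
have [fbm_coord _ Bcont] := fbmB.
have d0 : 0 < d%:R :> R by rewrite ltr0n.
have dim_fin : hausdorff_dim A \is a fin_num.
  by rewrite ge0_fin_numE ?(ltW dimA_gt0)// (le_lt_trans dimA_le)// ltry.
set D := fine (hausdorff_dim A).
have dimE : hausdorff_dim A = D%:E by rewrite /D fineK.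
have DH : D <= H * d%:R by rewrite -lee_fin -dimE.
have alphaD : d%:R * alpha < D.
  move: alphaA; rewrite dimE inver gt_eqF// -EFinM lte_fin ltr_pdivlMr//.
  by rewrite mulrC.
have alpha1 : 0 < alpha <= 1.
  rewrite alpha0/=; have /andP[_ H1] := H01.
  have : d%:R * alpha < d%:R * H by rewrite [d%:R * H]mulrC; exact: lt_le_trans DH.
  by rewrite ltr_pM2l// => /ltW/le_trans; apply; exact: ltW.
(* The two gaps around s pay for the Hoelder exponent and for the mass. *)
pose s := (d%:R * alpha + D) / 2.
have s0 : 0 < s by have : 0 < d%:R * alpha by [rewrite mulr_gt0]; rewrite /s; lra.
have das : d%:R * alpha < s by rewrite /s; lra.
have sA : (s%:E < hausdorff_dim A)%E by rewrite dimE lte_fin /s; lra.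
have [m m1 hm] := subdivision_choice alpha0 s0 das.
have m0 : (0 < m)%N := ltnW m1.
have m0R n : 0 < m%:R ^+ n :> R by rewrite exprn_gt0// ltr0n.
have b1 : (1 < 8 * nshifts d m)%N by rewrite (leq_trans _ (leq_pmulr 8 (nshifts_gt0 d m0))).
have [C [tau [C0 Atau tau_homo tau_sep]]] := cantor_parametrization s0 A01 Aclosed sA b1.
have tau01 v : `[0, 1]%classic (tau v) by exact/A01/Atau.
pose y v w i := B (tau v) w 0 i.
have Bcoord i w : {within `[0, 1], continuous (fun t => B t w 0 i)}.
  apply/subspace_continuousP => t t01.
  have /subspace_continuousP/(_ _ t01) h := Bcont w.
  apply: (cvg_comp (fun t => B t w) (fun M : 'rV[R]_d => M 0 i) h).
  exact: coord_continuous.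
have my i : measurable_fun setT (fun p : R * T => y p.1 p.2 i).
  apply: (measurable_time_changed_process (X := fun t w => B t w 0 i)) => //.
  by move=> t t01; exact: fbm_measurable (fbm_coord i) t01.
have [xi hxi] := fills_cell P m1 my.
have [Phi hPhi] := exists_limit R m1 xi.
have Phi_hoelder := limit_hoelder m1 alpha0 s0 C0 hm tau_sep hPhi.
set K := 4 * m%:R * C `^ (alpha / s) in Phi_hoelder.
have K0 : 0 <= K by rewrite /K !mulr_ge0// powR_ge0.
have [f hf] : exists f : R -> 'rV[R]_d,
    (forall v i, 0 <= v < 1 -> f (tau v) 0 i = Phi v i) /\
    forall x z, `|f x - f z| <= K * `|x - z| `^ alpha.
  have ext i : exists g : R -> R, (forall v, 0 <= v < 1 -> g (tau v) = Phi v i) /\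
      forall x z, `|g x - g z| <= K * `|x - z| `^ alpha.
    apply: (hoelder_extension (D := [set v | 0 <= v < 1]) alpha1 K0).
      by exists 0 => /=; rewrite lexx ltr01.
    by move=> u v u01 v01; exact: Phi_hoelder.
  have [g hg] := choice ext.
  exists (fun x => \row_i g i x); split=> [v i v01|x z].
    by rewrite mxE; exact: (hg i).1.
  apply: rV_norm_le => [|i]; first by rewrite mulr_ge0// powR_ge0.
  by rewrite !mxE; exact: (hg i).2.
have [ftau f_hoelder] := hf.
exists f; split; first by exists K; split=> // x z _ _; exact: f_hoelder.
have f_cont : continuous f.
  move=> x; apply/cvgrPdist_le => e e0.
  have e1 : 0 < (e / (K + 1)) `^ alpha^-1 by rewrite powR_gt0// divr_gt0// ltr_wpDl.
  near=> z.
  have xz : `|x - z| <= (e / (K + 1)) `^ alpha^-1 by near: z; exact: cvgr_dist_le.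
  apply: le_trans (f_hoelder x z) _.
  apply: (@le_trans _ _ (K * (e / (K + 1)))); last first.
    by rewrite mulrA ler_pdivrMr ?ltr_wpDl// mulrC ler_pM2l// lerDl.
  rewrite ler_wpM2l//.
  have eE : e / (K + 1) = ((e / (K + 1)) `^ alpha^-1) `^ alpha.
    by rewrite -powRrM mulVf ?gt_eqF// powRr1// divr_ge0 ?addr_ge0// ltW.
  by rewrite eE ge0_ler_powR// ?nnegrE ?powR_ge0// ltW.
apply: filterS hxi => w hw.
have cpt01 : compact (`[0, 1]%classic : set R) by exact: segment_compact.
have Acpt : compact A by exact: subclosed_compact cpt01 A01.
pose h t := B t w + f t.
have h_cont : {within A, continuous h}.
  apply: (continuous_subspaceW A01).
  move=> t; apply: continuousD; first exact: Bcont.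
  exact: continuous_subspaceT.
have hA_closed : closed [set h t | t in A].
  apply: compact_closed; first exact: norm_hausdorff.
  exact: continuous_compact.
have [b yb] : exists b, forall v i, 0 <= v < 1 -> `|y v w i| <= b.
  have := compact_bounded (continuous_compact (Bcont w) cpt01).
  move=> [b0 [_ hb]]; exists (b0 + 1) => v i _.
  apply: le_trans (rV_coord_le_norm _ _) _.
  by apply: (hb (b0 + 1)); [rewrite ltrDl|exists (tau v)].
have [n1 [q hq]] := hw (ex_intro _ b yb).
exists (\row_i ((q i + 1 / 2) / m%:R ^+ n1)).
apply/nbhs_ballP; exists (1 / 2 / m%:R ^+ n1); first by rewrite /= divr_gt0.
move=> z hz; apply: hA_closed => U /nbhs_ballP[e /= e0 eU].
(* The half-side of the cell is 1 / (2 * m ^ n1), so it contains the ball. *)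
have zq : unit_cell q (fun i => m%:R ^+ n1 * z 0 i).
  move=> i; move: hz; rewrite -ball_normE /= => hz.
  have := rV_coord_le_norm (\row_i ((q i + 1 / 2) / m%:R ^+ n1) - z) i.
  move=> /le_lt_trans/(_ hz); rewrite !mxE.
  have -> : (q i + 1 / 2) / m%:R ^+ n1 - z 0 i = (q i + 1 / 2 - m%:R ^+ n1 * z 0 i) / m%:R ^+ n1.
    by rewrite mulrBl [_ * z 0 i]mulrC mulfK// gt_eqF.
  rewrite normrM [X in _ * X < _]ger0_norm ?invr_ge0 ?(ltW (m0R n1))//.
  rewrite ltr_pM2r ?invr_gt0// ltr_norml => /andP[h1 h2].
  by apply/andP; split; lra.
(* At level n the cell has side m ^- n and the later displacements add at most
   2 * m ^- n, so n is taken so large that 3 * m ^- n < e. *)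
pose n := maxn n1 (Num.truncn (4 / e)).+1.
have [v v01 hv] := hq (fun i => z 0 i) zq n (leq_maxl _ _).
exists (h (tau v)); split; first by exists (tau v).
apply: eU; rewrite -ball_normE /=.
apply: (@le_lt_trans _ _ (3 * m%:R ^- n)).
  apply: rV_norm_le => [|i]; first by rewrite mulr_ge0// invr_ge0 ltW.
  rewrite !mxE ftau// distrC.
  have := hv i; have := hPhi v i n; rewrite /y !ler_norml => /andP[g1 g2] /andP[g3 g4].
  by apply/andP; split; lra.
rewrite ltr_pdivrMr// mulrC -ltr_pdivrMr//.
apply: (@lt_trans _ _ (4 / e)); first by rewrite ltr_pM2r ?invr_gt0//; lra.
apply: lt_trans (truncnS_gt _) _.
apply: (@le_lt_trans _ _ n%:R); first by rewrite ler_nat leq_maxr.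
by rewrite -natrX ltr_nat ltn_expl.
Unshelve. all: by end_near. Qed.
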